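(* Let $\gamma\in\{1,6\}$ and let $N\in\{1,2,3,5,8,13\}$. Then the $N$-point Fibonacci lattice is a global minimizer of the worst case error $\mathrm{wce}(H^{1,\gamma}_{\mathrm{mix}}(\mathbb{T}^2),\mathcal{P}_N)$ among all $N$-point sets $\mathcal{P}_N=\{p_1,\dots,p_N\}\subset[0,1)^2$ (points counted with multiplicity), and it is the unique global minimizer up to torus symmetries, i.e. every global minimizer is the image of the Fibonacci lattice under a torus symmetry.
   Context: $\mathbb{T}=[0,1)$ is the one-dimensional torus. For $\gamma>0$, $H^{1,\gamma}(\mathbb{T})$ is the Hilbert space of 1-periodic functions with first weak derivative in $L_2(\mathbb T)$, with inner product $(f,g)=\int_0^1 f\,dx\int_0^1 g\,dx+\gamma\int_0^1 f'g'\,dx$. Its reproducing kernel is $K_{1,\gamma}(x,y)=1+\gamma k(|x-y|)$, where $k(t)=\frac12(t^2-t+\frac16)$. The space $H^{1,\gamma}_{\mathrm{mix}}(\mathbb{T}^2)=H^{1,\gamma}(\mathbb{T})\otimes H^{1,\gamma}(\mathbb{T})$ is the Hilbert space tensor product, with reproducing kernel $K_{2,\gamma}((x_1,x_2),(y_1,y_2))=K_{1,\gamma}(x_1,y_1)K_{1,\gamma}(x_2,y_2)$. For $\mathcal{P}_N=\{p_1,\dots,p_N\}\subset[0,1)^2$, the worst case error is $$\mathrm{wce}(H^{1,\gamma}_{\mathrm{mix}}(\mathbb{T}^2),\mathcal{P}_N)=\sup_{\|f\|\le 1}\Big|\int_{[0,1)^2}f(x)\,dx-\frac1N\sum_{i=1}^N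 f(p_i)\Big|,$$ the supremum being over $f\in H^{1,\gamma}_{\mathrm{mix}}(\mathbb{T}^2)$. It satisfies $\mathrm{wce}^2=-1+\frac1{N^2}\sum_{i,j=1}^N K_{2,\gamma}(p_i,p_j)$. Fibonacci numbers: $F_1=F_2=1$, $F_{n+1}=F_n+F_{n-1}$. For $N=F_n$, $n\ge 2$, the Fibonacci lattice is $\{(\frac iN,\frac{iF_{n-1}}{N}\bmod 1): i=0,\dots,N-1\}$ (for $N=1$, the single point $(0,0)$). Torus symmetries are finite compositions of the following maps, applied simultaneously to all points of a point set: shifts $x\mapsto x+c \bmod 1$ of the first coordinate and shifts $y\mapsto y+c\bmod 1$ of the second coordinate ($c\in\mathbb{R}$), reflections $x\mapsto 1-x \bmod 1$ and $y\mapsto 1-y\bmod 1$ of either coordinate, and the interchange $(x,y)\mapsto(y,x)$. The points are unlabelled.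
   Formalization: The inner product is taken with weight 1/γ instead of γ on the integral of f'g', because only this weight gives the stated reproducing kernel 1+γk and the stated formula for the worst case error; for γ=1 the two agree. *)

(* Defs.v *)
From mathcomp Require Import all_boot all_order all_algebra perm.
From mathcomp Require Import all_classical all_reals all_analysis.
Set Implicit Arguments.
Unset Strict Implicit.
Unset Printing Implicit Defensive.
Import Order.TTheory GRing.Theory Num.Theory.
Import numFieldNormedType.Exports.
Local Open Scope classical_set_scope.
Local Open Scope ring_scope.

(* The torus T = [0, 1) and the square [0, 1)^2. *)
Definition torus (R : realType) : set R := [set x | 0 <= x < 1].
Definition torus2 (R : realType) : set (R * R) := @torus R `*` @torus R.
Arguments torus R : clear implicits.
Arguments torus2 R : clear implicits.

Definition leb (R : realType) : {measure set (measurableTypeR R) -> \bar R} :=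
  lebesgue_measure.
Arguments leb R : clear implicits.

Definition int1 (R : realType) (f : R -> R) : R :=
  Rintegral (leb R) (torus R) f.

Definition int2 (R : realType) (f : R * R -> R) : R :=
  Rintegral (leb R \x leb R)%E (torus2 R) f.

Definition periodic1 (R : realType) (f : R -> R) : Prop :=
  forall x, f (x + 1) = f x.

Definition smooth (R : realType) (f : R -> R) : Prop :=
  forall (n : nat) (x : R), derivable (derive1n n f) x 1.

(* g is a first weak derivative of f on T; since the test functions are
   1-periodic, integration by parts has no boundary term. *)
Definition weak_derivative (R : realType) (f g : R -> R) : Prop :=
  forall phi : R -> R, periodic1 phi -> smooth phi ->
    int1 (fun x => f x * derive1 phi x) = - int1 (fun x => g x * phi x).

Definition square_integrable (R : realType) (g : R -> R) : Prop :=
  measurable_fun (torus R : set (measurableTypeR R)) g /\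
  (leb R).-integrable (torus R) (fun x => ((g x) ^+ 2)%:E).

(* An element of H^1(T).  Elements are represented by their continuous
   representative, so that point evaluation makes sense.  The derivative is
   carried along as a function; it is determined up to a null set of T, which
   none of the integrals below can see. *)
Record H1 (R : realType) : Type := MkH1 {
  h1_fun :> R -> R;
  h1_der : R -> R;
  h1_periodic : periodic1 h1_fun;
  h1_continuous : continuous h1_fun;
  h1_der_L2 : square_integrable h1_der;
  h1_weak : weak_derivative h1_fun h1_der
}.

(* The inner product of H^{1,gamma}(T) is normalized so that the reproducing
   kernel is K(x, y) = 1 + gamma k(|x - y|), k(t) = (t^2 - t + 1/6) / 2.
   On T, k'' = 1 - delta_0 in the sense of distributions, so if w is the weight
   of int f' g', then (K(., x), f) = int f + w gamma (f(x) - int f), and the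
   reproducing property (K(., x), f) = f(x) forces w = 1 / gamma. *)
Definition h1_dot (R : realType) (gamma : R) (f g : H1 R) : R :=
  int1 f * int1 g + gamma^-1 * int1 (fun x => h1_der f x * h1_der g x).

(* The algebraic tensor product of H^{1,gamma}(T) with itself: the sequence of
   the (c_i, (u_i, v_i)) stands for sum_i c_i u_i (x) v_i.  *)
Definition tensor (R : realType) : Type := seq (R * (H1 R * H1 R)).

Definition tensor_eval (R : realType) (t : tensor R) (z : R * R) : R :=
  \sum_(a <- t) a.1 * (a.2.1 z.1 * a.2.2 z.2).

Definition tensor_dot (R : realType) (gamma : R) (s t : tensor R) : R :=
  \sum_(a <- s) \sum_(b <- t)
    a.1 * b.1 * (h1_dot gamma a.2.1 b.2.1 * h1_dot gamma a.2.2 b.2.2).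

Definition tensor_norm (R : realType) (gamma : R) (t : tensor R) : R :=
  Num.sqrt (tensor_dot gamma t t).

Definition tensor_sub (R : realType) (s t : tensor R) : tensor R :=
  s ++ [seq (- a.1, a.2) | a <- t].

Definition tensor_cauchy (R : realType) (gamma : R) (t : nat -> tensor R) :
    Prop :=
  forall e : R, 0 < e -> exists M : nat, forall m n : nat,
    (M <= m)%N -> (M <= n)%N ->
    tensor_norm gamma (tensor_sub (t m) (t n)) < e.

(* The Hilbert space tensor product is the completion of the algebraic one.
   Point evaluations are continuous for the tensor norm, so the completion is
   again a space of functions on T^2: its elements are the pointwise limits of
   Cauchy sequences of tensors.  [Hmix_norm gamma f r] says that f belongs to
   H^{1,gamma}_mix(T^2) and has norm r. *)
Definition Hmix_norm (R : realType) (gamma : R) (f : R * R -> R) (r : R) :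
    Prop :=
  exists t : nat -> tensor R,
    [/\ tensor_cauchy gamma t,
        forall z, (fun n => tensor_eval (t n) z) @ \oo --> f z
      & (fun n => tensor_norm gamma (t n)) @ \oo --> r].

Definition wce (R : realType) (gamma : R) (N : nat) (P : 'I_N -> R * R) :
    \bar R :=
  ereal_sup [set e : \bar R | exists (f : R * R -> R) (r : R),
    [/\ Hmix_norm gamma f r, r <= 1
      & e = `|int2 f - N%:R^-1 * \sum_(i < N) f (P i)|%:E]].

(* Point sets counted with multiplicity are families 'I_N -> [0, 1)^2, taken up
   to relabelling where this matters. *)
Definition point_set (R : realType) (N : nat) (P : 'I_N -> R * R) : Prop :=
  forall i, torus2 R (P i).

Definition global_minimizer (R : realType) (gamma : R) (N : nat)
    (P : 'I_N -> R * R) : Prop :=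
  point_set P /\
  forall Q : 'I_N -> R * R, point_set Q -> (wce gamma P <= wce gamma Q)%E.

Fixpoint fib (n : nat) : nat :=
  match n with
  | 0%N => 0%N
  | 1%N => 1%N
  | (m.+1 as p).+1 => (fib p + fib m)%N
  end.

Definition mod1 (R : realType) (x : R) : R := x - (Num.floor x)%:~R.

Definition fib_lattice (R : realType) (n : nat) (i : 'I_(fib n)) : R * R :=
  (i%:R / (fib n)%:R, mod1 ((i * fib n.-1)%N%:R / (fib n)%:R)).

Inductive torus_generator (R : realType) : (R * R -> R * R) -> Prop :=
| gen_shift1 (c : R) : torus_generator (fun z => (mod1 (z.1 + c), z.2))
| gen_shift2 (c : R) : torus_generator (fun z => (z.1, mod1 (z.2 + c)))
| gen_refl1 : torus_generator (fun z => (mod1 (1 - z.1), z.2))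
| gen_refl2 : torus_generator (fun z => (z.1, mod1 (1 - z.2)))
| gen_swap : torus_generator (fun z => (z.2, z.1)).

Inductive torus_symmetry (R : realType) : (R * R -> R * R) -> Prop :=
| sym_id : torus_symmetry id
| sym_comp (g s : R * R -> R * R) :
    torus_generator g -> torus_symmetry s -> torus_symmetry (g \o s).

(* Q is the image of P under a torus symmetry, as unlabelled point sets. *)
Definition torus_image (R : realType) (N : nat) (P Q : 'I_N -> R * R) : Prop :=
  exists (s : R * R -> R * R) (sigma : {perm 'I_N}),
    torus_symmetry s /\ forall i, Q (sigma i) = s (P i).

(* Main.v *)
(** Write k(t) = A + B (1 - 2 t)^2 for the univariate kernel.  By the reproducing
    property the worst case error is the norm of the Riesz representer of the
    integration error, and N^2 (wce^2 + 1) is the energy sum_(i, j) K(p_i, p_j).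

    Let sig and tau rank the points by their first and second coordinates.  Then
    N (1 - 2 |x_i - x_j|) = +- (saw (sig j - sig i) + xi_j - xi_i) for a deviation
    xi with zero sum, where saw a = N - 2 a, and similarly for y with tau, zeta.  Since
    A >= B for gamma <= 6, it suffices to bound from below a quartic expression in
    xi, zeta that depends on sig and tau.  For each N an integer certificate writes it
    as its value at the lattice, plus the squares
      sum_(s, t) (sum_i [sig_i = s] kap (tau_i - t) xi_i + G (sig_i - s) (tau_i - t))^2
    (and similar squares with another table H, and with sig, tau exchanged), plus a
    sum over pairs i <> j of expressions that are nonnegative and vanish only if
    tau j - tau i = +- k (sig j - sig i) and both deviation differences are 0.
    All pairs being lattice pairs forces tau = c +- k sig, which is a torus symmetry.

    The reproducing property comes from testing the weak derivative against
    trigonometric polynomials whose derivative is 1 minus the normalized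
    (1 + cos 2 pi u)^n, an approximate identity. *)

From Stdlib Require Import ZArith.
Require Import Defs.
From HB Require Import structures.
From mathcomp Require Import all_boot all_order all_algebra perm.
From mathcomp Require Import all_classical all_reals all_analysis.
From mathcomp Require Import measurable_realfun.
From mathcomp Require Import ssrZ zify ring lra.

Set Implicit Arguments.
Unset Strict Implicit.
Unset Printing Implicit Defensive.
Import Order.TTheory GRing.Theory Num.Theory.
Import numFieldNormedType.Exports.

(** * Certificates *)

(** For fixed rankings the absolute values become affine in the points, but there are far too many
    pairs of rankings to treat in turn. The certificate therefore sees them only through the
    differences [sig j - sig i] and [tau j - tau i] in Z/N, so that one certificate serves all of
    them. Summed over pairs, a function of [sig j - sig i] gives a constant, and such a function
    times xi_j - xi_i gives 0; these are free multipliers, [calpha] and the slope [g]. They do not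
    suffice: [calpha] alone leads to the best pairing of x-differences with y-differences, and for N
    = 13 this pairs 1 with 6, whereas the lattice pairs 1 with 5. The squares add positive definite
    functions on (Z/N)^2, as in linear programming bounds for codes. Their tables have zero sums
    along lattice lines, so nothing is lost at the lattice. Through [ckappa] they also supply terms
    linear in xi, at the price of a multiple of sum xi_i^2. Every gamma <= 6 reduces to the case A =
    B, hence the certificates do not depend on gamma. *)

Section Checker.
Local Open Scope Z_scope.

(* [cm] holds the points at which the quartic term is linearized, by u^2 >= 2 m u - m^2
   with u = (saw a + x) (saw b + y); the inequality is scaled by [cM] to clear denominators. *)
Record certificate := Certificate {
  cN : nat; ck : nat; cM : Z;
  ckappa : seq Z; cG : seq (seq Z); cH : seq (seq Z);
  calpha : seq Z; cm : seq (seq Z) }.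

Fixpoint dot (s t : seq Z) : Z :=
  match s, t with x :: s', y :: t' => x * y + dot s' t' | _, _ => 0 end.

Fixpoint dot2 (s t : seq (seq Z)) : Z :=
  match s, t with x :: s', y :: t' => dot x y + dot2 s' t' | _, _ => 0 end.

Definition entry (T : seq (seq Z)) (a b : nat) : Z := nth 0 (nth [::] T a) b.

Definition table (N : nat) (f : nat -> nat -> Z) : seq (seq Z) :=
  mkseq (fun a => mkseq (f a) N) N.

Definition correlation (T : seq (seq Z)) (a b : nat) : Z :=
  dot2 T (map (rot b) (rot a T)).

Definition ztab_p (N a : nat) : Z := Z.of_nat N - 2 * Z.of_nat a.

(** After linearization at [m], 2N times the form of a pair is at least e (x^2 + y^2) + 2 mu x y +
    2N (f x + f' y + r). At a lattice pair the origin must be a minimum of value zero, so [r], [f],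
    [f'] vanish and [m] is exactly p q; elsewhere the last test says that the minimum over x, y is
    positive. *)
Definition check_pair (N k : nat) (M e m al al' B B' D g g' p q : Z)
    (lattice : bool) : bool :=
  let mu := 2 * Z.of_nat N * M * m in
  let r := 2 * M * m * p * q - M * m * m - al - al' - D in
  let f := 2 * M * m * q + B - g in
  let f' := 2 * M * m * p + B' - g' in
  (Z.abs mu <? e) &&
  (if lattice then [&& m =? p * q, r =? 0, f =? 0 & f' =? 0]
   else 2 * Z.of_nat N * (e * (f * f) + e * (f' * f') - 2 * mu * (f * f'))
          <? 4 * r * (e * e - mu * mu)).

(** The line sums run over all translates of the lattice line, in both orientations because the
    squares also occur with [sig] and [tau] exchanged. Pairs start at 1: rankings are injective, so
    differences of distinct indices are nonzero. *)
Definition check (c : certificate) : bool :=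
  let N := cN c in let k := ck c in
  let idx := iota 0 N in
  let B := table N (fun a b => dot (ckappa c) (rot b (nth [::] (cG c) a))) in
  let D := table N (fun a b => correlation (cG c) a b + correlation (cH c) a b) in
  let W := dot (ckappa c) (ckappa c) in
  let e := 2 * Z.of_nat N * cM c * Z.of_nat N * Z.of_nat N - W in
  let g := mkseq (fun a => 2 * cM c * ztab_p N a
              * ztab_p N (k * a %% N) * ztab_p N (k * a %% N)
              + entry B a (k * a %% N)) N in
  [&& (0 <? cM c), size (ckappa c) == N,
      all (fun T => (size T == N) && all (fun r => size r == N) T)
        [:: cG c; cH c],
      all (fun a => all (fun b =>
        entry B ((N - a) %% N) ((N - b) %% N) =? - entry B a b) idx) idx,
      all (fun T => all (fun b =>
        (foldr Z.add 0 (map (fun j => entry T j ((k * j + b) %% N)) idx) =? 0) &&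
        (foldr Z.add 0 (map (fun j => entry T ((k * j + b) %% N) j) idx) =? 0))
        idx) [:: cG c; cH c] &
      all (fun a => all (fun b =>
        check_pair N k (cM c) e (entry (cm c) a b)
          (nth 0 (calpha c) a) (nth 0 (calpha c) b) (entry B a b) (entry B b a)
          (entry D a b + entry D b a) (nth 0 g a) (nth 0 g b)
          (ztab_p N a) (ztab_p N b)
          ((b == k * a %% N)%N || (b == (N - k * a %% N) %% N)%N))
        (behead idx)) (behead idx)].

End Checker.

(** * Correlations on (Z/N)^2 and the energy identity *)

Section Correlation.
Local Open Scope ring_scope.
Variables (R : realFieldType) (n : nat).
Local Notation V := 'I_n.+1.
Implicit Types (A B : V -> V -> R) (sig tau : V -> V) (xi : V -> R).

Definition corr A B (a b : V) : R :=
  \sum_s \sum_t A s t * B (s + a) (t + b).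

Lemma sum_shift (F : V -> R) (c : V) : \sum_s F (c - s) = \sum_s F s.
Proof.
rewrite [RHS](reindex_onto (fun s => c - s) (fun s => c - s)) /=; last first.
  by move=> s _; rewrite opprB addrCA subrr addr0.
by apply: eq_bigl => s; rewrite opprB addrCA subrr addr0 eqxx.
Qed.

(** Summing over all base points (s, t) is translation invariant, so a pair (i, j) contributes
    through its differences only. The substitution s -> sig i - s makes the argument of [A] the
    summation variable. *)
Lemma sum_corr A B sig tau (u v : V -> R) :
  \sum_s \sum_t (\sum_i u i * A (sig i - s) (tau i - t)) *
                (\sum_j v j * B (sig j - s) (tau j - t)) =
  \sum_i \sum_j u i * v j * corr A B (sig j - sig i) (tau j - tau i).
Proof.
under eq_bigr => s _ do under eq_bigr => t _ do rewrite big_distrlr /=.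
under eq_bigr => s _ do rewrite exchange_big /=.
rewrite exchange_big /=; apply: eq_bigr => i _.
under eq_bigr => s _ do rewrite exchange_big /=.
rewrite exchange_big /=; apply: eq_bigr => j _.
rewrite /corr big_distrr /= -(sum_shift _ (sig i)).
apply: eq_bigr => s _; rewrite big_distrr /= -(sum_shift _ (tau i)).
apply: eq_bigr => t _.
have e (x y z : V) : y - (x - z) = z + (y - x) by rewrite opprB addrCA.
by rewrite !e !subrr !addr0; ring.
Qed.

End Correlation.

Section Inequality.
Local Open Scope ring_scope.
Variables (R : realFieldType) (n k : nat).
Local Notation V := 'I_n.+1.
Local Notation N := (n.+1%:R : R).
Variables (M : R) (kap : V -> R) (G H : V -> V -> R) (alpha : V -> R).

Definition saw (a : V) : R := N - (val a)%:R *+ 2.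

Definition autocorr (a b : V) : R := corr G G a b + corr H H a b.
Definition crosscorr (a b : V) : R := \sum_t kap t * G a (t + b).
Definition kapnorm : R := \sum_t kap t ^+ 2.
(** Chosen to cancel the linear terms of [pair_form] at lattice pairs with zero deviation. The same
    function serves y because k^2 is 1 or -1 modulo N for the sizes treated: exchanging the
    coordinates preserves the lattice up to a reflection. *)
Definition slope (a : V) : R :=
  2 * M * saw a * saw (a *+ k) ^+ 2 + crosscorr a (a *+ k).

(** The share of a pair in M times the energy, minus its share of the squares and of the
    multipliers. The factor 1 / (2 N) spreads kapnorm sum xi_i^2 over the pairs, by [psum_sqr]. *)
Definition pair_form (a b : V) (x y : R) : R :=
  M * ((saw a + x) ^+ 2 * (saw b + y) ^+ 2 + N ^+ 2 * (x ^+ 2 + y ^+ 2))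
  - kapnorm / (2 * N) * (x ^+ 2 + y ^+ 2)
  + crosscorr a b * x + crosscorr b a * y - autocorr a b - autocorr b a
  - slope a * x - slope b * y - alpha a - alpha b.

(** For A = B this is N^4 times the kernel energy, up to an additive constant and the factor B^2.
    The terms linear in one deviation that come from a single coordinate are absent, because they
    sum to zero. *)
Definition energy (sig tau : V -> V) (xi zeta : V -> R) : R :=
  \sum_(i : V) \sum_(j : V | j != i)
   ((saw (sig j - sig i) + (xi j - xi i)) ^+ 2 *
    (saw (tau j - tau i) + (zeta j - zeta i)) ^+ 2 +
    N ^+ 2 * ((xi j - xi i) ^+ 2 + (zeta j - zeta i) ^+ 2)).

Definition lattice_pair (a b : V) : bool := (b == a *+ k) || (b == - (a *+ k)).

Hypothesis M_gt0 : 0 < M.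
Hypothesis crosscorr_odd : forall a b : V, crosscorr (- a) (- b) = - crosscorr a b.
Hypothesis G_vanish : forall t : V, \sum_j G j (j *+ k + t) = 0.
Hypothesis G_vanish' : forall t : V, \sum_j G (j *+ k + t) j = 0.
Hypothesis H_vanish : forall t : V, \sum_j H j (j *+ k + t) = 0.
Hypothesis H_vanish' : forall t : V, \sum_j H (j *+ k + t) j = 0.
Hypothesis form_lattice : forall a : V, a != 0 -> pair_form a (a *+ k) 0 0 = 0.
Hypothesis form_ge0 : forall (a b : V) x y, a != 0 -> b != 0 ->
  0 <= pair_form a b x y ?= iff [&& lattice_pair a b, x == 0 & y == 0].

Definition squares (sig tau : V -> V) (xi : V -> R) : R :=
  \sum_s \sum_t (\sum_i ((sig i == s)%:R * xi i * kap (tau i - t)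
                          + G (sig i - s) (tau i - t))) ^+ 2
  + \sum_s \sum_t (\sum_i H (sig i - s) (tau i - t)) ^+ 2.

Lemma squares_ge0 sig tau xi : 0 <= squares sig tau xi.
Proof. by apply: addr_ge0; do 2!apply: sumr_ge0 => ? _; exact: sqr_ge0. Qed.

Let K (a b : V) : R := (a == 0)%:R * kap b.

Lemma corrKK a b : corr K K a b = (a == 0)%:R * \sum_t kap t * kap (t + b).
Proof.
rewrite /corr (bigD1 0) //= [X in _ + X]big1 ?addr0; last first.
  by move=> s /negPf s0; rewrite big1 // => t _; rewrite /K s0 !mul0r.
rewrite big_distrr /=; apply: eq_bigr => t _; rewrite /K eqxx add0r mul1r.
by rewrite mulrCA.
Qed.

Lemma corrKG a b : corr K G a b = crosscorr a b.
Proof.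
rewrite /corr (bigD1 0) //= [X in _ + X]big1 ?addr0; last first.
  by move=> s /negPf s0; rewrite big1 // => t _; rewrite /K s0 !mul0r.
by apply: eq_bigr => t _; rewrite /K eqxx add0r mul1r.
Qed.

(** [K] lives on row 0, so its autocorrelation is concentrated at sig j = sig i. Injectivity of
    [sig] leaves only i = j, and no product xi_i xi_j of distinct deviations survives. *)
Lemma squaresE sig tau xi : injective sig ->
  squares sig tau xi = kapnorm * \sum_i xi i ^+ 2
   + 2 * \sum_i \sum_j xi i * crosscorr (sig j - sig i) (tau j - tau i)
   + \sum_i \sum_j autocorr (sig j - sig i) (tau j - tau i).
Proof.
move=> isig; rewrite /squares.
have e s t : \sum_i ((sig i == s)%:R * xi i * kap (tau i - t)
                          + G (sig i - s) (tau i - t)) =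
   \sum_i xi i * K (sig i - s) (tau i - t) +
   \sum_i 1 * G (sig i - s) (tau i - t).
  rewrite -big_split /=; apply: eq_bigr => i _.
  by rewrite /K subr_eq0 mul1r; congr (_ + _); rewrite mulrCA mulrA.
have sq (P Q : V -> V -> R) : \sum_s \sum_t (P s t + Q s t) ^+ 2 =
    \sum_s \sum_t P s t * P s t + 2 * (\sum_s \sum_t P s t * Q s t)
    + \sum_s \sum_t Q s t * Q s t.
  rewrite big_distrr -!big_split; apply: eq_bigr => s _ /=.
  by rewrite big_distrr -!big_split; apply: eq_bigr => t _ /=; ring.
under eq_bigr => s _ do under eq_bigr => t _ do rewrite e.
rewrite sq.
have -> : \sum_s \sum_t (\sum_i H (sig i - s) (tau i - t)) ^+ 2 =
  \sum_i \sum_j 1 * 1 * corr H H (sig j - sig i) (tau j - tau i).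
  rewrite -sum_corr; apply: eq_bigr => s _; apply: eq_bigr => t _.
  by rewrite expr2; congr (_ * _); apply: eq_bigr => i _; rewrite mul1r.
rewrite !sum_corr.
have -> : \sum_i \sum_j xi i * xi j * corr K K (sig j - sig i) (tau j - tau i)
   = kapnorm * \sum_i xi i ^+ 2.
  rewrite big_distrr /=; apply: eq_bigr => i _; rewrite (bigD1 i) //= [X in _ + X]big1.
    rewrite corrKK !subrr eqxx mul1r addr0 /kapnorm -expr2 mulrC.
    by congr (_ * _); apply: eq_bigr => t _; rewrite addr0 expr2.
  move=> j ji; rewrite corrKK subr_eq0 (inj_eq isig) (negPf ji).
  by rewrite !mul0r mulr0.
rewrite -!addrA; congr (_ + _); congr (2 * _ + _).
  by apply: eq_bigr => i _; apply: eq_bigr => j _; rewrite mulr1 corrKG.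
rewrite -big_split /=; apply: eq_bigr => i _; rewrite -big_split /=.
by apply: eq_bigr => j _; rewrite /autocorr !mul1r.
Qed.

Definition psum (F : V -> V -> R) : R :=
  \sum_(i : V) \sum_(j : V | j != i) F i j.

Lemma psumE (F : V -> V -> R) : psum F = \sum_i \sum_j F i j - \sum_i F i i.
Proof.
rewrite -sumrB; apply: eq_bigr => i _.
by rewrite [X in _ = X - _](bigD1 i) //= addrAC subrr add0r.
Qed.

Lemma psumD (F F' : V -> V -> R) : psum (fun i j : V => F i j + F' i j) = psum F + psum F'.
Proof. by rewrite -big_split; apply: eq_bigr => i _; rewrite -big_split. Qed.

Lemma psumZ c (F : V -> V -> R) : psum (fun i j : V => c * F i j) = c * psum F.
Proof. by rewrite big_distrr; apply: eq_bigr => i _; rewrite -big_distrr. Qed.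

Lemma eq_psum (F F' : V -> V -> R) : (forall i j, i != j -> F i j = F' i j) -> psum F = psum F'.
Proof.
move=> e; apply: eq_bigr => i _; apply: eq_bigr => j ji.
by rewrite e // eq_sym.
Qed.

Lemma sum_diff_l sig (f : V -> R) (i : V) : injective sig ->
  \sum_(j : V | j != i) f (sig j - sig i) = \sum_(a : V | a != 0) f a.
Proof.
move=> isig; have bij : bijective (fun j => sig j - sig i).
  by apply: injF_bij => x y /addIr /isig.
rewrite [RHS](reindex _ (onW_bij _ bij)) /=.
by apply: eq_bigl => j; rewrite subr_eq0 (inj_eq isig).
Qed.

Lemma sum_diff_r sig (f : V -> R) (j : V) : injective sig ->
  \sum_(i : V | i != j) f (sig j - sig i) = \sum_(a : V | a != 0) f a.
Proof.
move=> isig; have bij : bijective (fun i => sig j - sig i).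
  by apply: injF_bij => x y /addrI /oppr_inj /isig.
rewrite [RHS](reindex _ (onW_bij _ bij)) /=.
by apply: eq_bigl => i; rewrite subr_eq0 (inj_eq isig) eq_sym.
Qed.

Lemma psum_swap (F : V -> V -> R) : psum F = psum (fun i j : V => F j i).
Proof.
rewrite /psum (exchange_big_dep (fun _ : V => true)) //=; apply: eq_bigr => i _.
by apply: eq_bigl => j; rewrite eq_sym.
Qed.

Lemma psum_diff sig (f : V -> R) : injective sig ->
  psum (fun i j : V => f (sig j - sig i)) = N * \sum_(a : V | a != 0) f a.
Proof.
move=> isig; rewrite /psum (eq_bigr (fun=> \sum_(a : V | a != 0) f a)) => [|i _].
  by rewrite sumr_const card_ord mulr_natl.
by rewrite sum_diff_l.
Qed.

(** For fixed i both [sig j - sig i] and [sig i - sig j] run once through the nonzero residues, so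
    the two coefficients of xi_i cancel. Hence any slope function may be subtracted without changing
    the energy. *)
Lemma psum_diff_lin sig (f : V -> R) (xi : V -> R) : injective sig ->
  psum (fun i j : V => f (sig j - sig i) * (xi j - xi i)) = 0.
Proof.
move=> isig; rewrite (@eq_psum _ (fun i j : V => f (sig j - sig i) * xi j
   + (-1) * (f (sig j - sig i) * xi i))) => [|i j _]; last by ring.
rewrite psumD psumZ [X in X + _]psum_swap /psum mulN1r -sumrB big1 // => i _.
by rewrite -!big_distrl sum_diff_l // sum_diff_r // subrr.
Qed.

Lemma psum_sqr (xi : V -> R) : \sum_i xi i = 0 ->
  psum (fun i j : V => (xi j - xi i) ^+ 2) = 2 * N * \sum_i xi i ^+ 2.
Proof.
move=> xi0; rewrite psumE [X in _ - X]big1 ?subr0; last first.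
  by move=> i _; rewrite subrr expr0n.
rewrite (eq_bigr (fun i => \sum_j xi j ^+ 2 + N * xi i ^+ 2)) => [|i _].
  rewrite big_split /= sumr_const card_ord -big_distrr /= -mulr_natl; ring.
rewrite (eq_bigr (fun j => xi j ^+ 2 + (xi i ^+ 2 - 2 * xi i * xi j))).
  rewrite big_split /= sumrB sumr_const card_ord.
  have -> : \sum_j 2 * xi i * xi j = 0 by rewrite -mulr_sumr xi0 mulr0.
  by rewrite subr0 mulr_natl.
by move=> j _; ring.
Qed.

(** Exchanging i and j turns the terms with xi_j into terms with xi_i; by oddness the two halves add
    up instead of cancelling. *)
Lemma psum_cross sig tau (xi : V -> R) :
  psum (fun i j : V => crosscorr (sig j - sig i) (tau j - tau i) * (xi j - xi i)) =
  - (2 * \sum_i \sum_j xi i * crosscorr (sig j - sig i) (tau j - tau i)).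
Proof.
rewrite psumE [X in _ - X]big1 ?subr0; last by move=> i _; rewrite (subrr (xi i)) mulr0.
under eq_bigr => i _ do under eq_bigr => j _ do rewrite mulrBr.
under eq_bigr => i _ do rewrite sumrB.
rewrite sumrB exchange_big /= -sumrB big_distrr -sumrN; apply: eq_bigr => i _ /=.
rewrite -sumrB big_distrr -sumrN; apply: eq_bigr => j _ /=.
by rewrite -(opprB (sig j)) -(opprB (tau j)) crosscorr_odd; ring.
Qed.

Lemma psum_autocorr sig tau :
  psum (fun i j : V => autocorr (sig j - sig i) (tau j - tau i)) =
  \sum_i \sum_j autocorr (sig j - sig i) (tau j - tau i) - N * autocorr 0 0.
Proof.
rewrite psumE; congr (_ - _); under eq_bigr => i _ do rewrite !subrr.
by rewrite sumr_const card_ord mulr_natl.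
Qed.

(** The multipliers give N sum alpha for each coordinate. The other term is the diagonal i = j,
    which both families of squares contain and the sum over pairs omits. *)
Definition energy_bound : R :=
  2 * N * (\sum_(a : V | a != 0) alpha a) - 2 * N * autocorr 0 0.

Lemma energy_identity sig tau xi zeta : injective sig -> injective tau ->
  \sum_i xi i = 0 -> \sum_i zeta i = 0 ->
  M * energy sig tau xi zeta =
  psum (fun i j : V => pair_form (sig j - sig i) (tau j - tau i)
                             (xi j - xi i) (zeta j - zeta i))
  + squares sig tau xi + squares tau sig zeta + energy_bound.
Proof.
move=> isig itau xi0 zeta0; rewrite !squaresE // /energy -/(psum _) -psumZ.
pose Q (i j : V) := pair_form (sig j - sig i) (tau j - tau i) (xi j - xi i) (zeta j - zeta i).
(* Besides the form, every summand is one whose sum over pairs is known: squared deviations, odd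
   linear terms, correlations, slopes and multipliers. *)
rewrite (@eq_psum _ (fun i j : V => Q i j + (
   kapnorm / (2 * N) * (xi j - xi i) ^+ 2 +
   (kapnorm / (2 * N) * (zeta j - zeta i) ^+ 2 +
   ((-1) * (crosscorr (sig j - sig i) (tau j - tau i) * (xi j - xi i)) +
   ((-1) * (crosscorr (tau j - tau i) (sig j - sig i) * (zeta j - zeta i)) +
   (autocorr (sig j - sig i) (tau j - tau i) +
   (autocorr (tau j - tau i) (sig j - sig i) +
   (slope (sig j - sig i) * (xi j - xi i) +
   (slope (tau j - tau i) * (zeta j - zeta i) +
   (alpha (sig j - sig i) + alpha (tau j - tau i)))))))))))); last first.
  by move=> i j _; rewrite /Q /pair_form; ring.
have psum10 (f0 f1 f2 f3 f4 f5 f6 f7 f8 f9 f10 : V -> V -> R) :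
  psum (fun i j : V => f0 i j + (f1 i j + (f2 i j + (f3 i j + (f4 i j +
    (f5 i j + (f6 i j + (f7 i j + (f8 i j + (f9 i j + f10 i j)))))))))) =
  psum f0 + (psum f1 + (psum f2 + (psum f3 + (psum f4 + (psum f5 +
    (psum f6 + (psum f7 + (psum f8 + (psum f9 + psum f10))))))))).
  by rewrite !psumD.
rewrite psum10 !psumZ !psum_sqr // !psum_cross !psum_diff_lin //.
rewrite (psum_diff alpha isig) (psum_diff alpha itau).
rewrite !psum_autocorr.
rewrite -/Q /energy_bound.
set X := \sum_i xi i ^+ 2; set Y := \sum_i zeta i ^+ 2.
by field; rewrite nat1r pnatr_eq0.
Qed.

Hypothesis k_inj : injective (fun a : V => a *+ k).

Let lat (a : V) : V := a *+ k.

Lemma sum_translate (F : V -> R) (c : V) : \sum_i F (i - c) = \sum_i F i.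
Proof.
by rewrite (reindex_inj (addIr c)); apply: eq_bigr => i _; rewrite addrK.
Qed.

Lemma squares_lattice : squares id lat (fun=> 0) = 0.
Proof.
(* Recentring at s turns the sum into one over a lattice line with offset [lat s - t]. *)
have e (F : V -> V -> R) s t : (forall u, \sum_j F j (j *+ k + u) = 0) ->
    \sum_i F (i - s) (lat i - t) = 0.
  move=> F0; rewrite -[RHS](F0 (lat s - t)) -[RHS](sum_translate _ s).
  by apply: eq_bigr => i _; rewrite addrA /lat mulrnBl subrK.
rewrite /squares [X in X + _]big1 ?[X in _ + X]big1 ?addr0 // => s _.
  by rewrite big1 // => t _; rewrite e ?expr0n.
rewrite big1 // => t _; under eq_bigr => i _ do rewrite mulr0 mul0r add0r.
by rewrite e ?expr0n.
Qed.

Lemma squares_lattice' : squares lat id (fun=> 0) = 0.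
Proof.
have e (F : V -> V -> R) s t : (forall u, \sum_j F (j *+ k + u) j = 0) ->
    \sum_i F (lat i - s) (i - t) = 0.
  move=> F0; rewrite -[RHS](F0 (lat t - s)) -[RHS](sum_translate _ t).
  by apply: eq_bigr => i _; rewrite addrA /lat mulrnBl subrK.
rewrite /squares [X in X + _]big1 ?[X in _ + X]big1 ?addr0 // => s _.
  by rewrite big1 // => t _; rewrite e ?expr0n.
rewrite big1 // => t _; under eq_bigr => i _ do rewrite mulr0 mul0r add0r.
by rewrite e ?expr0n.
Qed.

(** Pair forms and squares all vanish at the lattice, so the bound is its energy and never has to be
    evaluated numerically. *)
Lemma energy_lattice : M * energy id lat (fun=> 0) (fun=> 0) = energy_bound.
Proof.
rewrite energy_identity ?big1 // squares_lattice squares_lattice' !addr0.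
rewrite /psum big1 ?add0r // => i _; rewrite big1 // => j ji.
have -> : lat j - lat i = (j - i) *+ k by rewrite mulrnBl.
rewrite /= oppr0.
by rewrite form_lattice // subr_eq0.
Qed.

Lemma energy_min sig tau xi zeta : injective sig -> injective tau ->
  \sum_i xi i = 0 -> \sum_i zeta i = 0 ->
  energy id lat (fun=> 0) (fun=> 0) <= energy sig tau xi zeta /\
  (energy sig tau xi zeta <= energy id lat (fun=> 0) (fun=> 0) ->
   forall i j, i != j -> [/\ lattice_pair (sig j - sig i) (tau j - tau i),
     xi i = xi j & zeta i = zeta j]).
Proof.
move=> isig itau xi0 zeta0.
have := energy_identity isig itau xi0 zeta0; rewrite -energy_lattice.
pose P (i j : V) := pair_form (sig j - sig i) (tau j - tau i) (xi j - xi i) (zeta j - zeta i).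
have P0 i j : j != i -> 0 <= P i j ?= iff
    [&& lattice_pair (sig j - sig i) (tau j - tau i), xi j - xi i == 0 & zeta j - zeta i == 0].
  by move=> ij; apply: form_ge0; rewrite subr_eq0 inj_eq.
have S0 : 0 <= psum P by do 2!apply: sumr_ge0 => ? ?; rewrite P0.
have := squares_ge0 sig tau xi; have := squares_ge0 tau sig zeta.
move=> Q'0 Q0; rewrite -/(psum P) => E; split.
  by rewrite -(ler_pM2l M_gt0) E; lra.
rewrite -(ler_pM2l M_gt0) E => le i j ij.
have /eqP : psum P = 0 by lra.
rewrite psumr_eq0 => [/allP/(_ i (mem_index_enum _))|i' _]; last first.
  by apply: sumr_ge0 => j' ?; rewrite P0.
rewrite psumr_eq0 => [/allP/(_ j (mem_index_enum _))|j' ?]; last by rewrite P0.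
have ji : j != i by rewrite eq_sym.
by rewrite ji eq_sym P0 // !subr_eq0 => /and3P[-> /eqP -> /eqP ->].
Qed.

End Inequality.

(** * Soundness of the integer checker over an ordered field *)

Section Bridge.
Local Open Scope ring_scope.
Variable R : realFieldType.

(** Certificates are checked in binary integers, where [vm_compute] is fast; this ring morphism
    carries the results to the field. *)
Definition zr (z : Z) : R := (int_of_Z z)%:~R.

Lemma zrD x y : zr (Z.add x y) = zr x + zr y.
Proof. by rewrite /zr -rmorphD -rmorphD. Qed.

Lemma zrM x y : zr (Z.mul x y) = zr x * zr y.
Proof. by rewrite /zr -rmorphM -rmorphM. Qed.

Lemma zrN x : zr (Z.opp x) = - zr x.
Proof. by rewrite /zr -rmorphN -rmorphN. Qed.

Lemma zrB x y : zr (Z.sub x y) = zr x - zr y.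
Proof. by rewrite -zrN -zrD. Qed.

Lemma zr_nat n : zr (Z.of_nat n) = n%:R.
Proof. by rewrite /zr; have -> : int_of_Z (Z.of_nat n) = n by lia. Qed.

Lemma zr2 : zr 2 = 2. Proof. by []. Qed.

Lemma zr_lt x y : Z.ltb x y -> zr x < zr y.
Proof. by move=> xy; rewrite /zr ltr_int; lia. Qed.

Lemma zr_abs x : zr (Z.abs x) = `|zr x|.
Proof. by rewrite /zr -intr_norm; congr (_%:~R); lia. Qed.

Lemma zr_eq x y : Z.eqb x y -> zr x = zr y.
Proof. by move=> /Z.eqb_eq ->. Qed.

Definition zrE := (zrD, zrB, zrN, zrM, zr_abs, zr_nat, zr2).

Lemma dot_sum m (s t : seq Z) : size s = m -> size t = m ->
  zr (dot s t) = \sum_(i < m) zr (nth Z0 s i) * zr (nth Z0 t i).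
Proof.
elim: m s t => [|m IH] [|x s] [|y t] //=; first by rewrite big_ord0.
by move=> [ss] [st]; rewrite big_ord_recl /= zrD zrM IH.
Qed.

Lemma dot2_sum m l (S T : seq (seq Z)) : size S = m -> size T = m ->
  all (fun r => size r == l) S -> all (fun r => size r == l) T ->
  zr (dot2 S T) = \sum_(i < m) \sum_(j < l) zr (entry S i j) * zr (entry T i j).
Proof.
elim: m S T => [|m IH] [|x S] [|y T] //=; first by rewrite big_ord0.
move=> [sS] [sT] /andP[/eqP sx aS] /andP[/eqP sy aT].
by rewrite big_ord_recl /= zrD IH // (@dot_sum l).
Qed.

Lemma foldr_sum m (f : nat -> Z) :
  zr (foldr Z.add Z0 [seq f j | j <- iota 0 m]) = \sum_(j < m) zr (f j).
Proof.
rewrite -(big_mkord xpredT (fun j => zr (f j))) /index_iota subn0.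
by elim: (iota 0 m) => [|j s IH] /=; rewrite ?big_nil ?big_cons ?zrD ?IH.
Qed.

Section Size.
Variable n : nat.
Local Notation V := 'I_n.+1.

Lemma nth_rot (T : Type) (x0 : T) s (a b : V) : size s = n.+1 ->
  nth x0 (rot a s) b = nth x0 s (b + a)%R.
Proof.
move=> ss; rewrite /rot nth_cat size_drop ss nth_drop.
have := ltn_ord a; have := ltn_ord b => hb ha.
have -> : nat_of_ord (b + a) = ((b + a) %% n.+1)%N by [].
case: ifP => h; first by rewrite modn_small; [rewrite addnC|lia].
rewrite nth_take; last lia.
have -> : ((b + a) = (b - (n.+1 - a)) + n.+1)%N by lia.
by rewrite modnDr modn_small //; lia.
Qed.

Lemma val_mulrn (a : V) k : nat_of_ord (a *+ k) = ((k * a) %% n.+1)%N.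
Proof. by rewrite Zp_mulrn /= mulnC. Qed.

Lemma all_ord (f : nat -> bool) : all f (iota 0 n.+1) -> forall a : V, f a.
Proof. by move/allP => h a; apply: h; rewrite mem_iota /=. Qed.

Lemma all_ord_neq0 (f : nat -> bool) :
  all f (behead (iota 0 n.+1)) -> forall a : V, a != 0 -> f a.
Proof.
move/allP => h a a0; apply: h; rewrite /= mem_iota lt0n.
by have -> : nat_of_ord a != 0%N; [apply: contra a0 => /eqP a0; apply/eqP/val_inj | rewrite ltn_ord].
Qed.

Lemma entry_table (f : nat -> nat -> Z) (a b : V) :
  entry (table n.+1 f) a b = f a b.
Proof. by rewrite /entry /table !nth_mkseq. Qed.

End Size.

(** Multiplying by e (e^2 - mu^2) > 0 allows both squares to be completed without dividing by e;
    what remains is the assumed gap. *)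
Lemma quadratic_gt0 (c e mu r f f' x y : R) : 0 < c -> `|mu| < e ->
  c * (e * (f * f) + e * (f' * f') - 2 * mu * (f * f'))
    < 4 * r * (e * e - mu * mu) ->
  0 < e * (x ^+ 2 + y ^+ 2) + 2 * mu * (x * y) + c * (f * x + f' * y + r).
Proof.
move=> c0; rewrite ltr_norml => /andP[mu1 mu2] h.
have e0 : 0 < e by lra.
have d0 : 0 < e * e - mu * mu.
  have -> : e * e - mu * mu = (e - mu) * (e + mu) by ring.
  by apply: mulr_gt0; lra.
rewrite -(pmulr_rgt0 _ (mulr_gt0 e0 d0)).
have -> : e * (e * e - mu * mu) * (e * (x ^+ 2 + y ^+ 2) + 2 * mu * (x * y)
   + c * (f * x + f' * y + r)) =
  (e * e - mu * mu) * (e * x + mu * y + c * f / 2) ^+ 2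
  + ((e * e - mu * mu) * y + c * (e * f' - mu * f) / 2) ^+ 2
  + c * e * (4 * r * (e * e - mu * mu)
     - c * (e * (f * f) + e * (f' * f') - 2 * mu * (f * f'))) / 4 by field.
apply: ltr_wpDl; first by apply: addr_ge0; [apply: mulr_ge0; [exact: ltW | exact: sqr_ge0] | exact: sqr_ge0].
by apply: mulr_gt0; [apply: mulr_gt0; [exact: mulr_gt0 | rewrite subr_gt0] | rewrite invr_gt0].
Qed.

(** By 2 |x y| <= x^2 + y^2 the form dominates (e - |mu|) (x^2 + y^2). *)
Lemma quadratic_ge0 (e mu x y : R) : `|mu| < e ->
  0 <= e * (x ^+ 2 + y ^+ 2) + 2 * mu * (x * y) ?= iff (x == 0) && (y == 0).
Proof.
move=> me; have e0 : 0 < e by exact: le_lt_trans me.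
have : `|mu * (2 * (x * y))| <= `|mu| * (x ^+ 2 + y ^+ 2).
  rewrite normrM ler_wpM2l // ler_norml; apply/andP; split.
    by rewrite -subr_ge0 (_ : _ - _ = (x + y) ^+ 2) ?sqr_ge0 //; ring.
  by rewrite -subr_ge0 (_ : _ - _ = (x - y) ^+ 2) ?sqr_ge0 //; ring.
rewrite ler_norml => /andP[h _].
have s0 : 0 <= x ^+ 2 + y ^+ 2 by apply: addr_ge0; exact: sqr_ge0.
have k : (e - `|mu|) * (x ^+ 2 + y ^+ 2) <= e * (x ^+ 2 + y ^+ 2) + 2 * mu * (x * y).
  by lra.
have k0 : 0 <= (e - `|mu|) * (x ^+ 2 + y ^+ 2) by apply: mulr_ge0 => //; lra.
split; first exact: le_trans k.
apply/idP/idP => [/eqP q0|/andP[/eqP -> /eqP ->]].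
  have : (e - `|mu|) * (x ^+ 2 + y ^+ 2) = 0 by lra.
  move/eqP; rewrite mulf_eq0 => /orP[/eqP|]; first by lra.
  by rewrite paddr_eq0 ?sqr_ge0 // !sqrf_eq0.
by apply/eqP; ring.
Qed.

End Bridge.

Section CheckPair.
Local Open Scope ring_scope.
Variable R : realFieldType.
Local Notation zr := (zr R).

Lemma check_pair_sound n k (M W e m al al' B B' D g g' p q : Z) lattice (x y : R) :
  0 < zr M ->
  e = Z.sub (Z.mul (Z.mul (Z.mul (Z.mul 2 (Z.of_nat n.+1)) M) (Z.of_nat n.+1))
                   (Z.of_nat n.+1)) W ->
  check_pair n.+1 k M e m al al' B B' D g g' p q lattice ->
  0 <= zr M * ((zr p + x) ^+ 2 * (zr q + y) ^+ 2 + n.+1%:R ^+ 2 * (x ^+ 2 + y ^+ 2))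
       - zr W / (2 * n.+1%:R) * (x ^+ 2 + y ^+ 2)
       + zr B * x + zr B' * y - zr D - zr g * x - zr g' * y - zr al - zr al'
  ?= iff [&& lattice, x == 0 & y == 0].
Proof.
move=> M0 eE; rewrite /check_pair; set F := (X in _ -> 0 <= X ?= iff _).
set r := Z.sub (Z.sub (Z.sub (Z.sub _ _) _) _) _.
set f := Z.sub (Z.add _ _) _; set f' := Z.sub (Z.add _ _) _.
set mu := Z.mul _ m.
have N_gt0 : 0 < 2 * (n.+1%:R : R) by rewrite mulr_gt0 // ltr0n.
(* The square dropped by the linearization is kept as an exact term: it is nonnegative, and zero at
   a lattice pair with x = y = 0, where m = p q. *)
have key : 2 * n.+1%:R * F =
   2 * n.+1%:R * zr M * ((zr p + x) * (zr q + y) - zr m) ^+ 2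
   + (zr e * (x ^+ 2 + y ^+ 2) + 2 * zr mu * (x * y)
      + 2 * n.+1%:R * (zr f * x + zr f' * y + zr r)).
  rewrite /F /f /f' /r /mu eE !zrE.
  by field; rewrite nat1r pnatr_eq0.
have Nz : zr (Z.of_nat n.+1) = n.+1%:R by rewrite zr_nat.
clearbody F r f f' mu.
move=> /andP[/(zr_lt R) me chk]; rewrite zr_abs in me.
have sq0 : 0 <= 2 * n.+1%:R * zr M * ((zr p + x) * (zr q + y) - zr m) ^+ 2.
  by rewrite mulr_ge0 ?sqr_ge0 // mulr_ge0 // ltW.
case: ifP chk => _.
  case/and4P => /(zr_eq R) hm /(zr_eq R) hr /(zr_eq R) hf /(zr_eq R) hf'.
  have [q1 q2] := quadratic_ge0 x y me.
  move: key; rewrite hr hf hf' !mul0r !addr0 mulr0 addr0 => key.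
  split; first by rewrite -(pmulr_rge0 _ N_gt0) key addr_ge0.
  apply/idP/idP => [/eqP f0|/and3P[_ /eqP x0 /eqP y0]].
    rewrite /= -q2 eq_sym eq_le q1 andbT; move: key; rewrite -f0 mulr0; lra.
  have : 2 * n.+1%:R * F = 0 by rewrite key hm zrM x0 y0; ring.
  by move/eqP; rewrite mulf_eq0 (gt_eqF N_gt0) eq_sym.
move=> /(zr_lt R); rewrite !zrE => h.
have F0 : 0 < F.
  rewrite -(pmulr_rgt0 _ N_gt0) key; apply: ltr_wpDl sq0 _.
  exact: (quadratic_gt0 _ _ N_gt0 me).
by split; [exact: ltW | rewrite lt_eqF].
Qed.

End CheckPair.

Section Soundness.
Local Open Scope ring_scope.
Variables (R : realFieldType) (c : certificate) (n : nat).
Hypothesis cNE : cN c = n.+1.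
Hypothesis c_ok : check c.
Local Notation V := 'I_n.+1.
Local Notation k := (ck c).
Local Notation zr := (zr R).

Definition kapR (t : V) : R := zr (nth Z0 (ckappa c) t).
Definition tabR (T : seq (seq Z)) (a b : V) : R := zr (entry T a b).
Definition alphaR (a : V) : R := zr (nth Z0 (calpha c) a).

Local Notation cross := (crosscorr kapR (tabR (cG c))).
Local Notation auto := (autocorr (tabR (cG c)) (tabR (cH c))).
Local Notation form :=
  (pair_form k (zr (cM c)) kapR (tabR (cG c)) (tabR (cH c)) alphaR).

Let wf (T : seq (seq Z)) := (size T == n.+1) && all (fun r => size r == n.+1) T.

Lemma crosscorr_dot (a b : V) : size (ckappa c) = n.+1 -> wf (cG c) ->
  zr (dot (ckappa c) (rot b (nth [::] (cG c) a))) = cross a b.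
Proof.
move=> sk /andP[/eqP sG /allP aG].
have sa : size (nth [::] (cG c) a) = n.+1 by apply/eqP/aG/mem_nth; rewrite sG.
rewrite (@dot_sum _ n.+1) ?size_rot //; apply: eq_bigr => t _.
by rewrite nth_rot.
Qed.

Lemma correlation_corr T (a b : V) : wf T ->
  zr (correlation T a b) = corr (tabR T) (tabR T) a b.
Proof.
move=> /andP[/eqP sT aT]; rewrite /correlation (@dot2_sum _ n.+1 n.+1) //.
- apply: eq_bigr => s _; apply: eq_bigr => t _; congr (_ * zr _).
  rewrite /entry (nth_map [::]) ?size_rot ?sT // nth_rot // nth_rot //.
  by apply/eqP/(allP aT)/mem_nth; rewrite sT.
- by rewrite size_map size_rot.
- rewrite all_map; apply: sub_all (_ : all (fun r => size r == n.+1) _).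
    by move=> r; rewrite /= size_rot.
  by rewrite (eq_all_r (mem_rot _ _)).
Qed.

Lemma saw_ztab (a : V) : zr (ztab_p n.+1 a) = saw R a.
Proof. by rewrite /ztab_p !zrE /saw mulr_natl. Qed.

Lemma zr_mkseq (f : nat -> Z) (a : V) : zr (nth Z0 (mkseq f n.+1) a) = zr (f a).
Proof. by rewrite nth_mkseq. Qed.

Lemma check_unfold :
  [/\ 0 < zr (cM c),
      forall a b : V, cross (- a) (- b) = - cross a b,
      forall T, T \in [:: cG c; cH c] -> forall t : V,
        \sum_j tabR T j (j *+ k + t) = 0 /\ \sum_j tabR T (j *+ k + t) j = 0 &
      forall a b : V, a != 0 -> b != 0 ->
        forall x y, 0 <= form a b x y ?= iff [&& lattice_pair k a b, x == 0 & y == 0]].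
Proof.
have := c_ok; rewrite /check cNE.
case/and5P => M0 /eqP sk /and3P[wG wH _] odd /andP[van pairs].
have Bcross (a b : V) : zr (entry (table n.+1 (fun a b => dot (ckappa c) (rot b (nth [::] (cG c) a)))) a b) = cross a b.
  by rewrite entry_table crosscorr_dot.
have Dauto (a b : V) : zr (entry (table n.+1 (fun a b => Z.add (correlation (cG c) a b) (correlation (cH c) a b))) a b) = auto a b.
  by rewrite entry_table zrD !correlation_corr.
split.
- exact: (zr_lt R M0).
- move=> a b; have /(zr_eq R) := all_ord (all_ord odd a) b.
  (* [check] writes -a as (N - a) mod N, which is convertible to the opposite in ['I_n.+1]. *)
  by rewrite zrN -![((n.+1 - _) %% _)%N]/(nat_of_ord (- _)) !Bcross.
- move=> T Tin t; have := all_ord (allP van _ Tin) t.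
  case/andP => /(zr_eq R) h1 /(zr_eq R) h2; move: h1 h2; rewrite !foldr_sum.
  have e (j : V) : ((k * j + t) %% n.+1)%N = nat_of_ord (j *+ k + t).
    by rewrite /= val_mulrn modnDml.
  move=> h1 h2; split; [rewrite -[RHS]h1 | rewrite -[RHS]h2];
    by apply: eq_bigr => j _; rewrite /tabR e.
- move=> a b a0 b0 x y; have := all_ord_neq0 (all_ord_neq0 pairs a0) b0.
  have -> : ((b : nat) == ((k * a) %% n.+1)%N) ||
      ((b : nat) == ((n.+1 - (k * a) %% n.+1) %% n.+1)%N)
      = lattice_pair k a b.
    by rewrite /lattice_pair -!val_eqE -!val_mulrn.
  move=> /(check_pair_sound x y (zr_lt R M0) (erefl _)).
  have gE (f : nat -> Z) (a' : V) : f a' = Z.add (Z.mul (Z.mul (Z.mul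
      (Z.mul 2 (cM c)) (ztab_p n.+1 a')) (ztab_p n.+1 (k * a' %% n.+1)))
      (ztab_p n.+1 (k * a' %% n.+1))) (entry (table n.+1 (fun a b =>
        dot (ckappa c) (rot b (nth [::] (cG c) a)))) a' (k * a' %% n.+1)) ->
      zr (nth Z0 (mkseq f n.+1) a') = slope k (zr (cM c)) kapR (tabR (cG c)) a'.
    move=> fE; rewrite zr_mkseq fE zrD !zrM -val_mulrn !saw_ztab Bcross.
    by rewrite /slope expr2 mulrA.
  rewrite !gE // (zrD _ (entry _ _ _) (entry _ _ _)) !Bcross !Dauto !saw_ztab.
  have -> : zr (dot (ckappa c) (ckappa c)) = kapnorm kapR.
    by rewrite (@dot_sum _ n.+1) //; apply: eq_bigr => t _; rewrite -expr2.
  by congr (_ <= _ ?= iff _); rewrite /pair_form /alphaR; ring.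
Qed.

Lemma certified_energy_min (sig tau : V -> V) (xi zeta : V -> R) :
  injective (fun a : V => a *+ k) -> injective sig -> injective tau ->
  \sum_i xi i = 0 -> \sum_i zeta i = 0 ->
  energy id (fun a : V => a *+ k) (fun=> 0 : R) (fun=> 0 : R) <= energy sig tau xi zeta /\
  (energy sig tau xi zeta <= energy id (fun a : V => a *+ k) (fun=> 0 : R) (fun=> 0 : R) ->
   forall i j, i != j -> [/\ lattice_pair k (sig j - sig i) (tau j - tau i),
     xi i = xi j & zeta i = zeta j]).
Proof.
move=> ki isig itau xi0 zeta0.
have [M0 odd van fm] := check_unfold.
have vG := van _ (mem_head _ _).
have vH := van (cH c) (mem_last (cG c) [:: cH c]).
apply: (energy_min (H := tabR (cH c)) (alpha := alphaR) M0 odd) => //.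
- by move=> t; have [] := vG t.
- by move=> t; have [] := vG t.
- by move=> t; have [] := vH t.
- by move=> t; have [] := vH t.
(* The value 0 at the lattice is the equality case at zero deviation; injectivity of multiplication
   by k makes the second difference nonzero. *)
- move=> a a0; have ka0 : a *+ k != 0 by rewrite -(mul0rn _ k) (inj_eq ki).
  have [_ h] := fm a (a *+ k) a0 ka0 0 0.
  by apply/esym/eqP; rewrite h /lattice_pair !eqxx.
- by move=> a b x y a0 b0; exact: fm.
Qed.

End Soundness.

(** * Numerical certificates for the six sizes *)

Section Certificates.
Local Open Scope Z_scope.

(** For N <= 3 [ckappa], [cG] and [cH] vanish: the multipliers alone suffice. *)
Definition cert1 : certificate := Certificate 1 1 1 [:: 0] [:: [:: 0]] [:: [:: 0]] [:: 0] [:: [:: 0]].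

Definition cert2 : certificate := Certificate 2 1 2 [:: 0; 0]
  [::
   [:: 0; 0];
   [:: 0; 0]]
  [::
   [:: 0; 0];
   [:: 0; 0]]
  [:: 0; 0]
  [::
   [:: 0; 0];
   [:: 0; 0]].

Definition cert3 : certificate := Certificate 3 2 2 [:: 0; 0; 0]
  [::
   [:: 0; 0; 0];
   [:: 0; 0; 0];
   [:: 0; 0; 0]]
  [::
   [:: 0; 0; 0];
   [:: 0; 0; 0];
   [:: 0; 0; 0]]
  [:: 0; 1; 1]
  [::
   [:: 0; 0; 0];
   [:: 0; 1; -1];
   [:: 0; -1; 1]].

Definition cert5 : certificate := Certificate 5 3 1 [:: 8; 3; -7; -7; 3]
  [::
   [:: 0; 0; 0; 0; 0];
   [:: 0; 0; 1; 1; 0];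
   [:: -1; 0; 0; 0; 0];
   [:: 1; 0; 0; 0; 0];
   [:: 0; 0; -1; -1; 0]]
  [::
   [:: 0; 0; -1; -1; 0];
   [:: 0; 0; 0; 0; 0];
   [:: -1; 0; 1; 1; 0];
   [:: -1; 0; 1; 1; 0];
   [:: 0; 0; 0; 0; 0]]
  [:: 0; 29; -13; -13; 29]
  [::
   [:: 0; 0; 0; 0; 0];
   [:: 0; 6; 3; -3; -6];
   [:: 0; 3; 2; -2; -3];
   [:: 0; -3; -2; 2; 3];
   [:: 0; -6; -3; 3; 6]].

(** Here and for N = 13, [ckappa] and the rows of [cG] and [cH] are multiples of cos(2 pi t / N) up
    to small integer corrections; [cG] is odd and [cH] even in the row index. *)
Definition cert8 : certificate := Certificate 8 5 16 [:: 47; 33; 0; -33; -47; -33; 0; 33]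
  [::
   [:: 0; 0; 0; 0; 0; 0; 0; 0];
   [:: -13; -8; 0; 8; 12; 8; 0; -8];
   [:: -13; -10; 0; 10; 13; 10; 0; -10];
   [:: -8; -5; 0; 5; 7; 5; 0; -5];
   [:: 0; 0; 0; 0; 0; 0; 0; 0];
   [:: 8; 5; 0; -5; -7; -5; 0; 5];
   [:: 13; 10; 0; -10; -13; -10; 0; 10];
   [:: 13; 8; 0; -8; -12; -8; 0; 8]]
  [::
   [:: 8; 6; 0; -6; -8; -6; 0; 6];
   [:: 3; 2; 0; -2; -3; -2; 0; 2];
   [:: -4; -3; 0; 3; 4; 3; 0; -3];
   [:: -3; -2; 0; 2; 3; 2; 0; -2];
   [:: 0; 0; 0; 0; 0; 0; 0; 0];
   [:: -3; -2; 0; 2; 3; 2; 0; -2];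
   [:: -4; -3; 0; 3; 4; 3; 0; -3];
   [:: 3; 2; 0; -2; -3; -2; 0; 2]]
  [:: 0; 7059; 2048; -1531; -2864; -1531; 2048; 7059]
  [::
   [:: 0; 0; 0; 0; 0; 0; 0; 0];
   [:: 0; 28; 22; 12; 0; -12; -22; -28];
   [:: 0; 22; 16; 9; 0; -9; -16; -22];
   [:: 0; 12; 9; 4; 0; -4; -9; -12];
   [:: 0; 0; 0; 0; 0; 0; 0; 0];
   [:: 0; -12; -9; -4; 0; 4; 9; 12];
   [:: 0; -22; -16; -9; 0; 9; 16; 22];
   [:: 0; -28; -22; -12; 0; 12; 22; 28]].

Definition cert13 : certificate := Certificate 13 8 1681 [:: 768; 680; 436; 93; -272; -575; -746; -746; -575; -272; 93; 436; 680]
  [::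
   [:: 0; 0; 0; 0; 0; 0; 0; 0; 0; 0; 0; 0; 0];
   [:: -247; -219; -140; -30; 88; 185; 240; 240; 185; 88; -30; -140; -219];
   [:: -294; -262; -168; -36; 105; 221; 287; 287; 221; 105; -36; -168; -262];
   [:: -240; -213; -137; -29; 85; 180; 234; 234; 180; 85; -29; -137; -213];
   [:: -179; -159; -102; -22; 64; 134; 174; 174; 134; 64; -22; -102; -159];
   [:: -137; -122; -78; -17; 49; 103; 134; 134; 103; 49; -17; -78; -122];
   [:: -40; -36; -23; -5; 15; 31; 40; 40; 31; 15; -5; -23; -36];
   [:: 40; 36; 23; 5; -15; -31; -40; -40; -31; -15; 5; 23; 36];
   [:: 137; 122; 78; 17; -49; -103; -134; -134; -103; -49; 17; 78; 122];
   [:: 179; 159; 102; 22; -64; -134; -174; -174; -134; -64; 22; 102; 159];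
   [:: 240; 213; 137; 29; -85; -180; -234; -234; -180; -85; 29; 137; 213];
   [:: 294; 262; 168; 36; -105; -221; -287; -287; -221; -105; 36; 168; 262];
   [:: 247; 219; 140; 30; -88; -185; -240; -240; -185; -88; 30; 140; 219]]
  [::
   [:: 180; 160; 103; 23; -64; -134; -174; -174; -134; -64; 23; 103; 160];
   [:: 68; 60; 38; 8; -24; -51; -66; -66; -51; -24; 8; 38; 60];
   [:: -73; -65; -42; -9; 26; 55; 71; 71; 55; 26; -9; -42; -65];
   [:: -124; -109; -70; -15; 44; 92; 120; 120; 92; 44; -15; -70; -109];
   [:: -48; -43; -27; -6; 17; 36; 47; 47; 36; 17; -6; -27; -43];
   [:: 19; 17; 11; 2; -7; -14; -19; -19; -14; -7; 2; 11; 17];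
   [:: 68; 60; 39; 8; -24; -51; -66; -66; -51; -24; 8; 39; 60];
   [:: 68; 60; 39; 8; -24; -51; -66; -66; -51; -24; 8; 39; 60];
   [:: 19; 17; 11; 2; -7; -14; -19; -19; -14; -7; 2; 11; 17];
   [:: -48; -43; -27; -6; 17; 36; 47; 47; 36; 17; -6; -27; -43];
   [:: -124; -109; -70; -15; 44; 92; 120; 120; 92; 44; -15; -70; -109];
   [:: -73; -65; -42; -9; 26; 55; 71; 71; 55; 26; -9; -42; -65];
   [:: 68; 60; 38; 8; -24; -51; -66; -66; -51; -24; 8; 38; 60]]
  [:: 0; 7500324; 4755704; 2047864; -43728; -1488853; -2226349; -2226349; -1488853; -43728; 2047864; 4755704; 7500324]
  [::
   [:: 0; 0; 0; 0; 0; 0; 0; 0; 0; 0; 0; 0; 0];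
   [:: 0; 81; 77; 68; 49; 33; 10; -10; -33; -49; -68; -77; -81];
   [:: 0; 77; 76; 63; 46; 30; 9; -9; -30; -46; -63; -76; -77];
   [:: 0; 68; 63; 53; 38; 24; 7; -7; -24; -38; -53; -63; -68];
   [:: 0; 49; 46; 38; 28; 17; 5; -5; -17; -28; -38; -46; -49];
   [:: 0; 33; 30; 24; 17; 9; 3; -3; -9; -17; -24; -30; -33];
   [:: 0; 10; 9; 7; 5; 3; 1; -1; -3; -5; -7; -9; -10];
   [:: 0; -10; -9; -7; -5; -3; -1; 1; 3; 5; 7; 9; 10];
   [:: 0; -33; -30; -24; -17; -9; -3; 3; 9; 17; 24; 30; 33];
   [:: 0; -49; -46; -38; -28; -17; -5; 5; 17; 28; 38; 46; 49];
   [:: 0; -68; -63; -53; -38; -24; -7; 7; 24; 38; 53; 63; 68];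
   [:: 0; -77; -76; -63; -46; -30; -9; 9; 30; 46; 63; 76; 77];
   [:: 0; -81; -77; -68; -49; -33; -10; 10; 33; 49; 68; 77; 81]].

Lemma certificates_ok :
  all check [:: cert1; cert2; cert3; cert5; cert8; cert13].
Proof. by vm_compute. Qed.

End Certificates.

(** * From point sets to rankings *)

Section Ranking.
Local Open Scope ring_scope.
Variables (R : realFieldType) (n : nat).
Local Notation V := 'I_n.+1.

(** Points may share a coordinate, so ties are broken by sorting and only the weak inequality holds;
    the signs of x_j - x_i need no more. *)
Lemma ranking_exists (x : V -> R) :
  exists2 sig : V -> V, injective sig &
    forall i j, (sig i < sig j)%N -> x i <= x j.
Proof.
pose le_x := relpre x <=%R.
have tot : total le_x by move=> i j; exact: le_total.
have tr : transitive le_x by move=> j i l; exact: le_trans.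
pose s := sort le_x (enum V).
have ms i : i \in s by rewrite mem_sort mem_enum.
have ss : size s = n.+1 by rewrite size_sort size_enum_ord.
have idx i : (index i s < n.+1)%N.
  by apply: (leq_trans _ (eq_leq ss)); rewrite index_mem.
exists (fun i => Ordinal (idx i)) => [i j [e]|i j /= lt_ij].
  by rewrite -(nth_index i (ms i)) e nth_index.
have /= := sorted_leq_nth tr (fun i => lexx (x i)) i (sort_sorted tot (enum V)) _ _ _ _ (ltnW lt_ij).
by rewrite -/s !nth_index // => -> //; rewrite inE ss.
Qed.

End Ranking.

Section PairEnergy.
Local Open Scope ring_scope.
Variables (R : realFieldType) (n : nat).
Local Notation V := 'I_n.+1.
Local Notation N := (n.+1%:R : R).

(** Centred because [psum_sqr] requires a zero sum; the mean drops out of all differences. It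
    vanishes exactly when x_i - sig_i / N does not depend on i. *)
Definition deviation (sig : V -> V) (x : V -> R) (i : V) : R :=
  2 * (sig i)%:R - 2 * N * x i
  - N^-1 * \sum_j (2 * (sig j)%:R - 2 * N * x j).

Lemma sum_deviation (sig : V -> V) (x : V -> R) : \sum_i deviation sig x i = 0.
Proof.
rewrite sumrB sumr_const card_ord -mulrnAl -[X in _ - X * _]mulr_natr mulVf.
  by rewrite mul1r subrr.
by rewrite pnatr_eq0.
Qed.

(** The difference in Z/N wraps around exactly when sig j < sig i. This adds N to it and reverses
    the sign of the whole expression, which the square forgets. *)
Lemma saw_deviation (sig : V -> V) (x : V -> R) i j : injective sig ->
  (forall i j, (sig i < sig j)%N -> x i <= x j) -> i != j ->
  (saw R (sig j - sig i) + (deviation sig x j - deviation sig x i)) ^+ 2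
  = (N * (1 - 2 * `|x i - x j|)) ^+ 2.
Proof.
move=> isig sx ij.
have -> : deviation sig x j - deviation sig x i
    = 2 * (sig j)%:R - 2 * (sig i)%:R - 2 * N * (x j - x i).
  by rewrite /deviation; ring.
have vE : nat_of_ord (sig j - sig i) = ((sig j + (n.+1 - sig i)) %% n.+1)%N.
  by rewrite /= modnDmr.
have := ltn_ord (sig i); have := ltn_ord (sig j) => hj hi.
rewrite /saw [val _]vE.
have [lt|lt|/val_inj/isig e] := ltngtP (sig i) (sig j); last by rewrite e eqxx in ij.
- have -> : (sig j + (n.+1 - sig i) = (sig j - sig i) + n.+1)%N by lia.
  rewrite modnDr modn_small; last lia.
  rewrite natrB ?(ltnW lt) // distrC ger0_norm ?subr_ge0 ?sx //; ring.
- rewrite modn_small; last lia.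
  rewrite natrD natrB ?(ltnW hi) // ger0_norm ?subr_ge0 ?sx //; ring.
Qed.

Variable gamma : R.

Definition torus_kernel (t : R) : R := 1 + gamma * ((t ^+ 2 - t + 6^-1) / 2).

Definition kernel_energy (x y : V -> R) : R :=
  \sum_i \sum_j torus_kernel `|x i - x j| * torus_kernel `|y i - y j|.

Let A := 1 - gamma / 24.
Let B := gamma / 8.

Lemma kernel_energyE (sig tau : V -> V) (x y : V -> R) :
  injective sig -> injective tau ->
  (forall i j, (sig i < sig j)%N -> x i <= x j) ->
  (forall i j, (tau i < tau j)%N -> y i <= y j) ->
  N ^+ 4 * kernel_energy x y =
    N ^+ 5 * torus_kernel 0 ^+ 2
    + (N * \sum_(a : V | a != 0) A * N ^+ 2 * (A * N ^+ 2 + 2 * B * saw R a ^+ 2))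
    + B ^+ 2 * energy sig tau (deviation sig x) (deviation tau y)
    + B * (A - B) * N ^+ 2 *
       psum (fun i j => (deviation sig x j - deviation sig x i) ^+ 2
                      + (deviation tau y j - deviation tau y i) ^+ 2).
Proof.
move=> isig itau sx sy.
set xi := deviation sig x; set zeta := deviation tau y.
pose F i j := torus_kernel `|x i - x j| * torus_kernel `|y i - y j|.
have -> : kernel_energy x y = N * torus_kernel 0 ^+ 2 + psum F.
  rewrite psumE /kernel_energy -/F.
  have -> : \sum_i F i i = N * torus_kernel 0 ^+ 2.
    rewrite (eq_bigr (fun=> torus_kernel 0 ^+ 2)) ?sumr_const ?card_ord ?mulr_natl // => i _.
    by rewrite /F !subrr normr0 expr2.
  by rewrite addrC subrK.
rewrite mulrDr mulrA -exprSr -!addrA; congr (_ + _).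
rewrite -psumZ.
(* In the product of A N^2 + B X^2 and A N^2 + B Y^2, the coefficient A B N^2 of the squared
   deviations is split as B^2 N^2 + B (A - B) N^2; the first part completes the energy. *)
rewrite (@eq_psum R n _ (fun i j => B ^+ 2 *
   ((saw R (sig j - sig i) + (xi j - xi i)) ^+ 2 *
    (saw R (tau j - tau i) + (zeta j - zeta i)) ^+ 2 +
    N ^+ 2 * ((xi j - xi i) ^+ 2 + (zeta j - zeta i) ^+ 2)) +
   (B * (A - B) * N ^+ 2 * ((xi j - xi i) ^+ 2 + (zeta j - zeta i) ^+ 2) +
   ((A * N ^+ 2 / 2) * (A * N ^+ 2 + 2 * B * saw R (sig j - sig i) ^+ 2) +
   ((A * N ^+ 2 / 2) * (A * N ^+ 2 + 2 * B * saw R (tau j - tau i) ^+ 2) +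
   (2 * A * B * N ^+ 2 * (saw R (sig j - sig i) * (xi j - xi i)) +
    2 * A * B * N ^+ 2 * (saw R (tau j - tau i) * (zeta j - zeta i)))))))); last first.
  move=> i j ij.
  have hx := saw_deviation isig sx ij; have hy := saw_deviation itau sy ij.
  have kE t : N ^+ 2 * torus_kernel t = A * N ^+ 2 + B * (N * (1 - 2 * t)) ^+ 2.
    by rewrite /torus_kernel /A /B; field.
  have -> : N ^+ 4 * F i j = (N ^+ 2 * torus_kernel `|x i - x j|) *
      (N ^+ 2 * torus_kernel `|y i - y j|) by rewrite /F; ring.
  by rewrite !kE -hx -hy -/xi -/zeta; field.
have psum6 (f0 f1 f2 f3 f4 f5 : V -> V -> R) :
  psum (fun i j : V => f0 i j + (f1 i j + (f2 i j + (f3 i j + (f4 i j + f5 i j))))) =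
  psum f0 + (psum f1 + (psum f2 + (psum f3 + (psum f4 + psum f5)))).
  by rewrite !psumD.
rewrite psum6 !(psumZ (2 * A * B * N ^+ 2)) !psum_diff_lin // !mulr0 !addr0.
rewrite (psumZ (B ^+ 2)) (psumZ (B * (A - B) * N ^+ 2)).
rewrite (psum_diff (fun a => (A * N ^+ 2 / 2) * (A * N ^+ 2 + 2 * B * saw R a ^+ 2)) isig).
rewrite (psum_diff (fun a => (A * N ^+ 2 / 2) * (A * N ^+ 2 + 2 * B * saw R a ^+ 2)) itau).
have -> : \sum_(a : V | a != 0) A * N ^+ 2 * (A * N ^+ 2 + 2 * B * saw R a ^+ 2) =
  2 * \sum_(a : V | a != 0) (A * N ^+ 2 / 2) * (A * N ^+ 2 + 2 * B * saw R a ^+ 2).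
  by rewrite mulr_sumr; apply: eq_bigr => a _; field.
have -> : 1 + (- (gamma / 24) - B) = A - B by rewrite addrA.
rewrite /energy -/(psum _); ring.
Qed.

End PairEnergy.

Section Rigidity.
Local Open Scope ring_scope.

(** Read in the order of [sig], [tau] moves by d or -d at each unit step. Injectivity forbids
    turning back, so the sign is constant and [tau] is affine in [sig]. *)
Lemma lattice_rigid n k (sig tau : 'I_n.+1 -> 'I_n.+1) :
  injective sig -> injective tau ->
  (forall i j, i != j -> lattice_pair k (sig j - sig i) (tau j - tau i)) ->
  exists c (e : bool),
    forall i, tau i = c + (if e then sig i *+ k else - (sig i *+ k)).
Proof.
case: n sig tau => [|n] sig tau isig itau lat.
  by exists 0, true => i; rewrite !ord1.
have [f fK Kf] := injF_bij isig.
pose u : 'I_n.+2 := inZp 1; pose d := u *+ k; pose p a := tau (f a).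
have ip : injective p by move=> a b /itau; exact: (can_inj Kf).
have step a : p (a + u) - p a = d \/ p (a + u) - p a = - d.
  have u0 : u != 0 by [].
  have e : a + u - a = u by rewrite addrAC subrr add0r.
  have ne : f a != f (a + u).
    by apply: contra u0 => /eqP/(can_inj Kf) h; rewrite -e -h subrr.
  have := lat _ _ ne.
  by rewrite !Kf e => /orP[] /eqP; [left|right].
have step2 a : p (a + u + u) - p (a + u) = p (a + u) - p a.
  (* Turning back repeats a value after two steps, which forces u + u = 0; then d = -d, and there
     was no turn after all. *)
  have ret : p (a + u + u) = p a -> - d = d.
    move/ip/eqP; rewrite -addrA -[X in _ == X]addr0 (inj_eq (addrI a)) => /eqP uu.
    apply/eqP; rewrite eq_sym -addr_eq0 /d -mulrnDl uu mul0rn //.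
  have tri x y z : z - y = - (y - x) -> z = x :> 'I_n.+2.
    by rewrite opprB => /addIr.
  case: (step a) (step (a + u)) => e1 [] e2; rewrite e1 e2 //.
    by apply: ret; apply: (tri _ (p (a + u))); rewrite e1 e2.
  by apply/esym/ret; apply: (tri _ (p (a + u))); rewrite e1 e2 opprK.
have stepn m : p (u *+ m.+1) - p (u *+ m) = p u - p 0.
  by elim: m => [|m IH] //; rewrite -IH !mulrSr step2.
have lin m : p (u *+ m) = p 0 + (p u - p 0) *+ m.
  elim: m => [|m IH]; first by rewrite addr0.
  by rewrite [(p u - p 0) *+ _]mulrSr addrA -IH -(stepn m) addrC subrK.
have uE (a : 'I_n.+2) : a = u *+ (a : nat) :> 'I_n.+2.
  by apply: ord_inj; rewrite val_mulrn (_ : (u : nat) = 1%N) // muln1 modn_small.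
exists (p 0), (p u - p 0 == d) => i.
rewrite -[tau i]/(tau i) -{1}(fK i) -/(p (sig i)) {1}(uE (sig i)) lin; congr (_ + _).
have du : d *+ (sig i : nat) = sig i *+ k by rewrite /d mulrnAC -uE.
case: eqP => [->//|nd]; have := step 0; rewrite add0r => -[//|->].
by rewrite mulNrn du.
Qed.

End Rigidity.

Section Minimality.
Local Open Scope ring_scope.
Variables (R : realFieldType) (c : certificate) (n : nat) (gamma : R).
Local Notation V := 'I_n.+1.
Local Notation N := (n.+1%:R : R).
Local Notation k := (ck c).
Hypothesis cNE : cN c = n.+1.
Hypothesis c_ok : check c.
Hypothesis k_inj : injective (fun a : V => a *+ k).
Hypothesis gamma_gt0 : 0 < gamma.
Hypothesis gamma_le6 : gamma <= 6.

Local Notation Elat := (kernel_energy gamma (fun i : V => (i : nat)%:R / N)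
  (fun i : V => ((i *+ k : V) : nat)%:R / N)).

Lemma deviation_self (sig : V -> V) :
  deviation sig (fun i => (sig i : nat)%:R / N) = (fun=> 0).
Proof.
have N0 : N != 0 by rewrite pnatr_eq0.
have z i : 2 * (sig i : nat)%:R - 2 * N * ((sig i : nat)%:R / N) = 0.
  by field; rewrite nat1r.
by apply/funext => i; rewrite /deviation z big1 ?mulr0 ?subr0.
Qed.

Lemma kernel_energy_min (x y : V -> R) :
  Elat <= kernel_energy gamma x y /\
  (kernel_energy gamma x y <= Elat ->
   exists (sig : V -> V) (b : V) (e : bool) (x0 y0 : R), injective sig /\
     forall i, x i = x0 + (sig i : nat)%:R / N /\
       y i = y0 + (nat_of_ord (b + (if e then sig i *+ k else - (sig i *+ k)))%R)%:R / N).
Proof.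
have N_gt0 : 0 < N by rewrite ltr0n.
have [sig isig sx] := ranking_exists x; have [tau itau sy] := ranking_exists y.
have mono (s : V -> V) i j : (s i < s j)%N -> (s i : nat)%:R / N <= (s j : nat)%:R / N.
  by move=> /ltnW; rewrite ler_pM2r ?invr_gt0 // ler_nat.
have El := kernel_energyE gamma (@inj_id V) k_inj (mono id) (mono (fun a => a *+ k)).
rewrite (deviation_self id) (deviation_self (fun a => a *+ k)) in El.
have E := kernel_energyE gamma isig itau sx sy.
have [le_e eq_e] := certified_energy_min cNE c_ok k_inj isig itau
  (sum_deviation sig x) (sum_deviation tau y).
have ps0 : psum (fun i j : V => (0 - 0) ^+ 2 + (0 - 0) ^+ 2) = 0 :> R.
  by rewrite /psum big1 // => i _; rewrite big1 // => j _; rewrite subrr expr0n addr0.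
rewrite ps0 mulr0 addr0 in El.
set D := psum _ in E.
have D0 : 0 <= D by do 2!(apply: sumr_ge0 => ? _); rewrite addr_ge0 ?sqr_ge0.
have B0 : 0 < (gamma / 8) ^+ 2 by rewrite exprn_gt0 // divr_gt0.
have C0 : 0 <= gamma / 8 * (1 - gamma / 24 - gamma / 8) * N ^+ 2.
  apply: mulr_ge0; last exact: sqr_ge0.
  have g8 : 0 <= gamma / 8 by rewrite divr_ge0 // ltW.
  apply: mulr_ge0 => //.
  (* This is where gamma <= 6 enters. *)
  have -> : 1 - gamma / 24 - gamma / 8 = (6 - gamma) / 6 by field.
  by rewrite divr_ge0 // subr_ge0.
have CD := mulr_ge0 C0 D0.
have N4 : 0 < N ^+ 4 by exact: exprn_gt0.
split.
  rewrite -(ler_pM2l N4) E El -[leRHS]addrA lerD2l.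
  by apply: (le_trans (ler_wpM2l (ltW B0) le_e)); rewrite lerDl.
rewrite -(ler_pM2l N4) E El -[leLHS]addrA lerD2l => le_E.
have {}eq_e : forall i j, i != j ->
    [/\ lattice_pair k (sig j - sig i) (tau j - tau i),
     deviation sig x i = deviation sig x j & deviation tau y i = deviation tau y j].
  by apply: eq_e; rewrite -(ler_pM2l B0); apply: le_trans le_E; rewrite lerDl.
have [b [e te]] : exists c (e : bool),
    forall i, tau i = c + (if e then sig i *+ k else - (sig i *+ k)).
  by apply: lattice_rigid => // i j /eq_e[].
have affine (s : V -> V) (z : V -> R) i :
    deviation s z i = deviation s z ord0 ->
    z i = z ord0 - (s ord0 : nat)%:R / N + (s i : nat)%:R / N.
  have N0 : N != 0 by rewrite pnatr_eq0.
  rewrite /deviation => /addIr h.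
  have -> : z i = (2 * (s i : nat)%:R - (2 * (s ord0 : nat)%:R - 2 * N * z ord0)) / (2 * N).
    by rewrite -h; field; rewrite nat1r.
  by field; rewrite nat1r.
have dev0 i : deviation sig x i = deviation sig x ord0 /\
    deviation tau y i = deviation tau y ord0.
  by have [->//|/eq_e[]] := eqVneq i ord0.
exists sig, b, e, (x ord0 - (sig ord0 : nat)%:R / N), (y ord0 - (tau ord0 : nat)%:R / N).
by split=> // i; have [dx dy] := dev0 i; rewrite -te; split; exact: affine.
Qed.

End Minimality.

(** * From affine rankings to torus symmetries *)

Section TorusImage.
Local Open Scope ring_scope.
Variable R : realType.

Lemma mod1_eq (z w : R) (m : int) : torus R w -> z = w + m%:~R -> mod1 z = w.
Proof.
rewrite /torus /= => /andP[w0 w1] ->; rewrite /mod1.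
have -> : Num.floor (w + m%:~R) = m.
  by apply: floor_def; rewrite intrD rmorph1; apply/andP; split; lra.
by rewrite addrK.
Qed.

Lemma mod1_int (z : R) : exists m : int, mod1 z = z + m%:~R.
Proof. by exists (- Num.floor z); rewrite /mod1 intrN. Qed.

Variable n : nat.
Local Notation V := 'I_n.+1.
Local Notation N := (n.+1%:R : R).

(** Arithmetic in Z/N agrees with that of representatives up to multiples of N; after division by N
    these are integers, which [mod1] absorbs. *)
Let natr_mod (m : nat) : exists q : int, (m %% n.+1)%N%:R = m%:R + q%:~R * N.
Proof.
exists (- (m %/ n.+1)%:Z);
have e : m%:R = (m %/ n.+1)%N%:R * N + (m %% n.+1)%N%:R :> R.
  by rewrite -natrM -natrD -divn_eq.
by rewrite e intrN -pmulrn; ring.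
Qed.

Lemma natr_ordD (a b : V) : exists q : int,
  (nat_of_ord (a + b)%R)%:R = a%:R + b%:R + q%:~R * N.
Proof. by have [q h] := natr_mod (a + b)%N; exists q; rewrite -natrD -h. Qed.

Lemma natr_ordN (a : V) : exists q : int,
  (nat_of_ord (- a)%R)%:R = - a%:R + q%:~R * N.
Proof.
have [q h] := natr_mod (n.+1 - a)%N; exists (q + 1); rewrite [LHS]h.
by rewrite natrB ?(ltnW (ltn_ord a)) // intrD rmorph1; ring.
Qed.

Lemma natr_ordMn (a : V) k : exists q : int,
  (nat_of_ord (a *+ k)%R)%:R = (a * k)%N%:R + q%:~R * N.
Proof. by rewrite val_mulrn mulnC; exact: natr_mod. Qed.

Definition rank1_lattice (k : nat) (i : V) : R * R :=
  (i%:R / N, mod1 ((i * k)%N%:R / N)).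

Lemma torus_image_rank1 (k : nat) (P : V -> R * R) (sig : V -> V) (b : V)
    (e : bool) (x0 y0 : R) :
  point_set P -> injective sig ->
  (forall i, (P i).1 = x0 + (sig i : nat)%:R / N /\
     (P i).2 = y0 + (nat_of_ord (b + (if e then sig i *+ k else - (sig i *+ k)))%R)%:R / N) ->
  torus_image (rank1_lattice k) P.
Proof.
move=> PP isig PE.
have N0 : N != 0 by rewrite pnatr_eq0.
pose s (z : R * R) := (mod1 (z.1 + x0),
  mod1 ((if e then z.2 else mod1 (1 - z.2)) + (y0 + b%:R / N))).
(* Lattice point i goes to the point of [P] whose rank is i, hence the inverse of [sig]. *)
exists s, (perm isig)^-1%g; split.
  have -> : s = (fun z => (z.1, mod1 (z.2 + (y0 + b%:R / N)))) \o
     ((if e then id else (fun z => (z.1, mod1 (1 - z.2)))) \o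
     ((fun z => (mod1 (z.1 + x0), z.2)) \o id)).
    by apply/funext => z; rewrite /s; case: e {PE s}.
  apply: sym_comp; first exact: gen_shift2.
  case: e {PE s}; last first.
    by apply: sym_comp; [exact: gen_refl2 | apply: sym_comp; [exact: gen_shift1 | exact: sym_id]].
  rewrite (_ : id \o _ = (fun z : R * R => (mod1 (z.1 + x0), z.2)) \o id) //.
  by apply: sym_comp; [exact: gen_shift1 | exact: sym_id].
move=> i; set j := (perm isig)^-1%g i.
have sj : sig j = i by rewrite -[sig j](permE isig) permKV.
have [PE1 PE2] := PE j; have [tx ty] := PP j.
rewrite sj in PE1 PE2.
rewrite [LHS]surjective_pairing /s /rank1_lattice /=; congr pair.
  by apply/esym; apply: (mod1_eq (m := 0)) => //; rewrite PE1 addr0 addrC.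
apply/esym; have [m hm] := mod1_int ((i * k)%N%:R / N).
have [q hq] := natr_ordMn i k.
case: e {PE s} PE2 => PE2.
  have [q' hq'] := natr_ordD b (i *+ k).
  apply: (mod1_eq (m := m - q - q')) => //.
  by rewrite PE2 hq' hq hm !intrD !intrN; field; rewrite nat1r.
have [m' hm'] := mod1_int (1 - mod1 ((i * k)%N%:R / N)).
have [q' hq'] := natr_ordD b (- (i *+ k)).
have [q'' hq''] := natr_ordN (i *+ k).
apply: (mod1_eq (m := 1 - m + m' + q - q'' - q')) => //.
by rewrite PE2 hq' hq'' hq hm' hm !intrD !intrN rmorph1; field; rewrite nat1r.
Qed.

End TorusImage.

(** * The reproducing property *)

Section TorusIntegral.
Local Open Scope classical_set_scope.
Local Open Scope ring_scope.
Variable R : realType.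
Implicit Types (f g F G : R -> R) (c : R).
Local Notation mu := (leb R).

Definition integrable1 f := mu.-integrable (torus R) (EFin \o f).

Lemma torus_itv : torus R = `[0, 1[%classic.
Proof. by apply/seteqP; split => x /=; rewrite in_itv. Qed.

Lemma measurable_torus : measurable (torus R : set (measurableTypeR R)).
Proof. by rewrite torus_itv; exact: measurable_itv. Qed.

Lemma leb_torus : mu (torus R) = 1%E.
Proof.
rewrite torus_itv; have := lebesgue_measure_itv (`[0, 1[ : interval R).
by rewrite /= lte_fin ltr01 oppr0 adde0.
Qed.

Hint Resolve measurable_torus : core.

Lemma int1D f g : integrable1 f -> integrable1 g ->
  int1 (fun x => f x + g x) = int1 f + int1 g.
Proof. by move=> *; rewrite /int1 RintegralD. Qed.

Lemma int1Z c f : integrable1 f -> int1 (fun x => c * f x) = c * int1 f.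
Proof. by move=> *; rewrite /int1 RintegralZl. Qed.

Lemma int1_cst c : int1 (fun=> c) = c.
Proof. by rewrite /int1 Rintegral_cst // leb_torus mulr1. Qed.

Lemma eq_int1 f g : (forall x, torus R x -> f x = g x) -> int1 f = int1 g.
Proof. by move=> fg; apply: eq_Rintegral => x; rewrite inE => /fg. Qed.

Lemma eq_integrable1 f g : (forall x, torus R x -> f x = g x) ->
  integrable1 f -> integrable1 g.
Proof. by move=> fg; apply: eq_integrable => // x; rewrite inE /= => /fg ->. Qed.

Lemma integrable1D f g : integrable1 f -> integrable1 g ->
  integrable1 (fun x => f x + g x).
Proof. by move=> fi gi; have := integrableD measurable_torus fi gi. Qed.

Lemma integrable1Z c f : integrable1 f -> integrable1 (fun x => c * f x).
Proof. by move=> fi; have := integrableZl measurable_torus c fi. Qed.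

Lemma integrable1_sum (I : Type) (s : seq I) (h : I -> R -> R) :
  (forall i, integrable1 (h i)) -> integrable1 (fun x => \sum_(i <- s) h i x).
Proof.
move=> hi; elim: s => [|i s IH].
  by apply: (@eq_integrable1 (fun=> 0)) => [x _|]; [rewrite big_nil | exact: integrable0].
apply: (@eq_integrable1 (fun x => h i x + \sum_(j <- s) h j x)) => [x _|].
  by rewrite big_cons.
exact: integrable1D.
Qed.

Lemma int1_sum (I : Type) (s : seq I) (h : I -> R -> R) :
  (forall i, integrable1 (h i)) ->
  int1 (fun x => \sum_(i <- s) h i x) = \sum_(i <- s) int1 (h i).
Proof.
move=> hi; elim: s => [|i s IH].
  by rewrite big_nil -[RHS](int1_cst 0); apply: eq_int1 => x _; rewrite big_nil.
rewrite big_cons -IH -int1D //; last exact: integrable1_sum.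
by apply: eq_int1 => x _; rewrite big_cons.
Qed.

Lemma continuous_integrable1 f : continuous f -> integrable1 f.
Proof.
move=> cf; rewrite /integrable1 torus_itv.
have ig : mu.-integrable `[0, 1]%classic (EFin \o f).
  apply: continuous_compact_integrable; first exact: segment_compact.
  exact: continuous_subspaceT.
by apply: integrableS ig => //; apply: subset_itvl; rewrite bnd_simp.
Qed.

(** The fundamental theorem for integrands with one jump, the shape of the kernel's derivative; [F1]
    and [F2] need not match at c. The case c = 0, with an empty first piece, serves integrands
    without a jump. *)
Lemma int1_piecewise c f f1 f2 F1 F2 : torus R c ->
  continuous f1 -> continuous f2 ->
  (forall x : R, is_derive x 1 F1 (f1 x)) -> (forall x : R, is_derive x 1 F2 (f2 x)) ->
  (forall x : R, 0 <= x < c -> f x = f1 x) -> (forall x : R, c <= x < 1 -> f x = f2 x) ->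
  integrable1 f /\ int1 f = F1 c - F1 0 + (F2 1 - F2 c).
Proof.
move=> /andP[c0 c1] cf1 cf2 dF1 dF2 e1 e2.
have FTC g G a b : continuous g -> (forall x : R, is_derive x 1 G (g x)) -> a <= b ->
    mu.-integrable `[a, b[%classic (EFin \o g) /\
    Rintegral mu `[a, b[%classic g = G b - G a.
  move=> cg dG ab.
  have ig : mu.-integrable `[a, b]%classic (EFin \o g).
    apply: continuous_compact_integrable; first exact: segment_compact.
    exact: continuous_subspaceT.
  have ig' : mu.-integrable `[a, b[%classic (EFin \o g).
    by apply: integrableS ig => //; apply: subset_itvl; rewrite bnd_simp.
  split=> //; move: ab; rewrite le_eqVlt => /orP[/eqP <-|ab].
    by rewrite set_itvco0 Rintegral_set0 subrr.
  have cG x : {for x, continuous G}.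
    by apply: differentiable_continuous; apply/derivable1_diffP; case: (dG x).
  rewrite Rintegral_itv_bndo_bndc // /Rintegral (@continuous_FTC2 _ g G) //.
  - exact: continuous_subspaceT.
  - split; first by move=> x _; case: (dG x).
    + exact/cvg_at_right_filter/cG.
    + exact/cvg_at_left_filter/cG.
  - by move=> x _; rewrite derive1E; case: (dG x).
have [i1 I1] := FTC f1 F1 0 c cf1 dF1 c0.
have [i2 I2] := FTC f2 F2 c 1 cf2 dF2 (ltW c1).
have tU : torus R = `[0, c[%classic `|` `[c, 1[%classic.
  by rewrite torus_itv; apply: itv_bndbnd_setU; rewrite bnd_simp // ltW.
have if1 : mu.-integrable `[0, c[%classic (EFin \o f).
  apply: eq_integrable i1 => // x; rewrite inE /= in_itv /= => h.
  by rewrite e1.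
have if2 : mu.-integrable `[c, 1[%classic (EFin \o f).
  apply: eq_integrable i2 => // x; rewrite inE /= in_itv /= => h.
  by rewrite e2.
have dsj : [disjoint `[0, c[%classic & `[c, 1[%classic].
  apply/disj_setPS => x []; rewrite /= !in_itv /= => /andP[_ xc] /andP[cx _].
  by move: (lt_le_trans xc cx); rewrite ltxx.
have int_f : integrable1 f.
  move/integrableP : (if1) => [m1 l1]; move/integrableP : (if2) => [m2 l2].
  have mA : measurable (`[0, c[%classic : set (measurableTypeR R)) by exact: measurable_itv.
  have mB : measurable (`[c, 1[%classic : set (measurableTypeR R)) by exact: measurable_itv.
  have mU := (measurable_funU _ mA mB).2 (conj m1 m2).
  apply/integrableP; rewrite tU; split => //.
  rewrite ge0_integral_setU //; first exact: lte_add_pinfty.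
  exact: measurableT_comp.
split=> //; rewrite /int1 tU Rintegral_setU //.
  rewrite -I1 -I2; congr (_ + _); apply: eq_Rintegral => x; rewrite inE /= in_itv /=.
    exact: e1.
  exact: e2.
by move: int_f; rewrite /integrable1 tU.
Qed.

Lemma continuous_square_integrable f : continuous f -> square_integrable f.
Proof.
move=> cf; split; last first.
  apply: continuous_integrable1 => x; exact: (cvgM (cf x) (cf x)).
exact: measurable_funS (continuous_measurable_fun cf).
Qed.

Lemma square_integrable_mul f g : square_integrable f -> square_integrable g ->
  integrable1 (fun x => f x * g x).
Proof.
move=> [mf f2] [mg g2].
have i : integrable1 (fun x => f x ^+ 2 + g x ^+ 2) by exact: integrable1D.
apply: le_integrable i => //.
  by apply/measurable_EFinP; exact: measurable_funM.
move=> x _; rewrite /= lee_fin [leRHS]ger0_norm ?addr_ge0 ?sqr_ge0 //.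
by rewrite ler_norml; apply/andP; split; nra.
Qed.

End TorusIntegral.

(** * Trigonometric test functions *)

Section TestFunctions.
Local Open Scope classical_set_scope.
Local Open Scope ring_scope.
Variable R : realType.
Implicit Types (t u c : R).

(** The triples are amplitude, frequency and phase. With a free phase the class is closed under
    derivatives and translations, which makes smoothness an induction. *)
Definition trigsum (s : seq (R * R * R)) t : R :=
  \sum_(a <- s) a.1.1 * sin (a.1.2 * t + a.2).

Definition dtrig (s : seq (R * R * R)) : seq (R * R * R) :=
  [seq (a.1.1 * a.1.2, a.1.2, a.2 + pi / 2) | a <- s].

Lemma is_derive_trigsum s t : is_derive t 1 (trigsum s) (trigsum (dtrig s) t).
Proof.
elim: s => [|a s IH].
  rewrite /trigsum big_nil (_ : (fun _ => _) = cst 0); last first.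
    by apply/funext => x; rewrite big_nil.
  exact: is_derive_cst.
have -> : trigsum (a :: s) = (fun t => a.1.1 * sin (a.1.2 * t + a.2)) + trigsum s.
  by apply/funext => x; rewrite /trigsum big_cons.
rewrite /trigsum /dtrig /= big_cons /=; apply: is_deriveD.
rewrite addrA sinDpihalf -mulrA.
have d1 : is_derive t 1 (fun t : R => a.1.2 * t + a.2) a.1.2.
  rewrite -[X in is_derive _ _ _ X]addr0 -{2}[a.1.2]mulr1.
  by apply: is_deriveD.
have d2 : is_derive t 1 (fun t : R => sin (a.1.2 * t + a.2))
    (a.1.2 * cos (a.1.2 * t + a.2)).
  by rewrite mulrC; exact: (@is_derive1_comp _ (@sin R) _ _ _ _ (is_derive_sin _) d1).
exact: is_deriveZ.
Qed.

Lemma smooth_trigsum s : smooth (trigsum s).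
Proof.
have e n : derive1n n (trigsum s) = trigsum (iter n dtrig s).
  elim: n => // n IH; rewrite derive1nS IH iterS; apply/funext => x.
  by rewrite derive1E; case: (is_derive_trigsum (iter n dtrig s) x).
by move=> n x; rewrite e; case: (is_derive_trigsum (iter n dtrig s) x).
Qed.

Lemma continuous_trigsum s : continuous (trigsum s).
Proof.
move=> x; apply: differentiable_continuous; apply/derivable1_diffP.
by case: (is_derive_trigsum s x).
Qed.

Lemma continuous_cos_scale b w : continuous (fun x : R => b * cos (w * x)).
Proof.
have -> : (fun x : R => b * cos (w * x)) = trigsum [:: (b, w, pi / 2)].
  by apply/funext => x; rewrite /trigsum big_seq1 /= sinDpihalf.
exact: continuous_trigsum.
Qed.

Lemma trigsum_shift s c :
  (fun t => trigsum s (t - c)) = trigsum [seq (a.1, a.2 - a.1.2 * c) | a <- s].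
Proof.
apply/funext => t; rewrite /trigsum big_map; apply: eq_bigr => a _ /=.
by rewrite mulrBr addrAC addrA.
Qed.

Definition cossum (s : seq (R * nat)) u : R :=
  \sum_(a <- s) a.1 * cos (2 * pi * a.2%:R * u).

Lemma power_cossum n : exists s, forall u,
  (1 + cos (2 * pi * u)) ^+ n = cossum s u.
Proof.
elim: n => [|n [s IH]].
  exists [:: (1, 0%N)] => u.
  by rewrite /cossum big_seq1 /= mulr0 mul0r cos0 mulr1.
(* Product-to-sum formula; frequency 0 lowered by one becomes 1, since cosine is even. *)
exists (flatten [seq [:: a; (a.1 / 2, a.2.+1);
   (a.1 / 2, if a.2 is k.+1 then k else 1%N)] | a <- s]) => u.
rewrite exprSr IH /cossum mulrDr mulr1 big_flatten /= big_map.
rewrite big_distrl -big_split; apply: eq_bigr => -[b k] _ /=.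
rewrite !big_cons big_nil /= addr0; congr (_ + _).
set v := 2 * pi * u.
have pr x : b * cos x * cos v = b / 2 * cos (x + v) + b / 2 * cos (x - v).
  by rewrite cosD cosB; field.
rewrite pr; congr (_ * cos _ + _ * _).
  by rewrite -natr1 /v; ring.
case: k => [|k]; last by congr cos; rewrite -natr1 /v; ring.
by rewrite mulr0 mul0r sub0r cosN /v mulr1.
Qed.

Definition cosmean (s : seq (R * nat)) : R := \sum_(a <- s | a.2 == 0%N) a.1.

(** An antiderivative of 1 - [cossum s] / [cosmean s]. Terms of frequency 0 are divided by 0 and
    become 0; in the derivative they are the ones that cancel the constant 1. *)
Definition sawtest (s : seq (R * nat)) : seq (R * R * R) :=
  [seq (- (a.1 / (cosmean s * (2 * pi * a.2%:R))), 2 * pi * a.2%:R, 0) | a <- s].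

Let twopi_neq0 : 2 * pi != 0 :> R.
Proof. by rewrite mulf_neq0 // gt_eqF // pi_gt0. Qed.

Lemma dtrig_sawtest s u : cosmean s != 0 ->
  trigsum (dtrig (sawtest s)) u = 1 - cossum s u / cosmean s.
Proof.
move=> m0; rewrite /trigsum /dtrig /sawtest !big_map /=.
have -> : 1 - cossum s u / cosmean s = (\sum_(a <- s)
    ((if a.2 == 0%N then a.1 else 0) - a.1 * cos (2 * pi * a.2%:R * u))) / cosmean s.
  by rewrite sumrB -big_mkcond /= mulrBl mulfV.
rewrite mulr_suml; apply: eq_bigr => -[b k] _ /=.
rewrite add0r sinDpihalf; case: k => [|k] /=.
  by rewrite !mulr0 !mul0r cos0 mulr1 subrr ?mul0r.
have p0 : pi != 0 :> R by rewrite gt_eqF // pi_gt0.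
rewrite add0r; set v := cos _; clearbody v; move: (pi : R) p0 => q q0; field.
by rewrite m0 q0 nat1r pnatr_eq0.
Qed.

Let sin2pin (k : nat) (x : R) : sin (x + 2 * pi * k%:R) = sin x.
Proof.
have -> : x + 2 * pi * k%:R = x + (pi *+ 2) *+ k.
  by rewrite -[(pi *+ 2) *+ k]mulr_natr -(mulr_natl pi 2).
exact: (periodicn (@sinD2pi R)).
Qed.

Lemma trigsum_sawtest1 s u : trigsum (sawtest s) (u + 1) = trigsum (sawtest s) u.
Proof.
rewrite /trigsum /sawtest !big_map; apply: eq_bigr => a _ /=.
by rewrite !addr0 (mulrDr _ u 1) mulr1 sin2pin.
Qed.

Lemma trigsum_sawtest0 s : trigsum (sawtest s) 0 = 0.
Proof.
rewrite /trigsum /sawtest !big_map big1 // => a _ /=.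
by rewrite !addr0 mulr0 sin0 mulr0.
Qed.

(** This zero fixes the constant of integration: it selects the limit u - 1/2. *)
Lemma trigsum_sawtest_half s : trigsum (sawtest s) (1 / 2) = 0.
Proof.
rewrite /trigsum /sawtest !big_map big1 // => a _ /=.
have -> : 2 * pi * a.2%:R * (1 / 2) + 0 = 0 + pi *+ a.2 :> R by rewrite -mulr_natr; field.
suff -> : sin (0 + pi *+ a.2) = 0 :> R by rewrite mulr0.
elim: a.2 => [|k IH]; first by rewrite addr0 sin0.
by rewrite mulrSr addrA sinDpi IH oppr0.
Qed.

Lemma cosmean_int1 s : int1 (cossum s) = cosmean s.
Proof.
rewrite /cossum int1_sum => [|a].
  rewrite /cosmean [RHS]big_mkcond; apply: eq_bigr => -[b [|k]] _ /=.
    by rewrite -[RHS]int1_cst; apply: eq_int1 => x _; rewrite mulr0 mul0r cos0 mulr1.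
  set w := 2 * pi * k.+1%:R.
  have w0 : w != 0 by rewrite mulf_neq0 // pnatr_eq0.
  pose F := trigsum [:: (b / w, w, 0)].
  have dF (x : R) : is_derive x 1 F (b * cos (w * x)).
    have := is_derive_trigsum [:: (b / w, w, 0)] x.
    by rewrite {2}/trigsum big_seq1 /= add0r sinDpihalf divfK.
  have t0 : torus R 0 by rewrite /torus /= lexx ltr01.
  have cf := @continuous_cos_scale b w.
  have [_ ->] := int1_piecewise t0 cf cf dF dF (fun x _ => erefl _) (fun x _ => erefl _).
  by rewrite subrr add0r /F /trigsum !big_seq1 /= mulr1 mulr0 !addr0 -(add0r w) sin2pin sin0 mulr0 subrr.
exact/continuous_integrable1/continuous_cos_scale.
Qed.

End TestFunctions.

(** * Concentration of the normalized powers *)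

Section ApproximateIdentity.
Local Open Scope classical_set_scope.
Local Open Scope ring_scope.
Variable R : realType.
Implicit Types (u c : R).

Let cos2pi1 u : cos (2 * pi * (u + 1)) = cos (2 * pi * u) :> R.
Proof.
by rewrite (mulrDr _ u 1) mulr1 mulr_natl cosD2pi.
Qed.

Let coslt (v w : R) : 0 <= v -> v < w -> w <= 1 / 2 -> cos (2 * pi * w) < cos (2 * pi * v) :> R.
Proof.
move=> v0 vw w1; have p0 : 0 < pi :> R by exact: pi_gt0.
have half z : 0 <= z -> z <= 1 / 2 -> 2 * pi * z \in `[0, pi].
  move=> z0 z1; rewrite in_itv /= mulr_ge0 ?mulr_ge0 ?pi_ge0 //=.
  have -> : 2 * pi * z = pi * (2 * z) by rewrite mulrA (mulrC pi).
  apply: ler_piMr; first exact: pi_ge0.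
  by move: z1; lra.
rewrite ltr_cos ?half //; first by rewrite ltr_pM2l // mulr_gt0.
- by move: v0 vw; lra.
- by move: w1 vw; lra.
Qed.

Let cosle (d u : R) : 0 < d <= 1 / 2 -> d <= u <= 1 - d ->
  cos (2 * pi * u) <= cos (2 * pi * d) :> R.
Proof.
move=> /andP[d0 d1] /andP[du ud].
have mono w : d <= w -> w <= 1 / 2 -> cos (2 * pi * w) <= cos (2 * pi * d) :> R.
  rewrite le_eqVlt => /orP[/eqP -> //|dw] w1.
  by apply/ltW/coslt => //; exact: ltW.
have [uh|uh] := leP u (1 / 2); first exact: mono.
have -> : cos (2 * pi * u) = cos (2 * pi * (1 - u)) :> R.
  by rewrite -[RHS]cosN -[RHS]cosD2pi -mulr_natl; congr cos; ring.
by apply: mono; lra.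
Qed.

(** At distance at least d from the integers the power is at most q^n, while its mean is at least (d
    / 2) r^n, where r is the base at d / 2. As r > q, this gives uniform decay without a formula for
    the mean. *)
Lemma saw_tests : exists phi D : nat -> R -> R,
  [/\ forall n c, smooth (fun t => phi n (t - c)),
      forall n u, phi n (u + 1) = phi n u /\ D n (u + 1) = D n u,
      forall n u, is_derive u 1 (phi n) (1 - D n u),
      forall n, continuous (D n) /\ (forall u, 0 <= D n u) &
      [/\ forall n, phi n 0 = 0, forall n, phi n (1 / 2) = 0 &
        forall d e, 0 < d < 1 / 2 -> 0 < e -> exists M, forall n u, (M <= n)%N ->
          d <= u <= 1 - d -> D n u <= e]].
Proof.
have [s sE] := choice (@power_cossum R).
have base0 u : 0 <= 1 + cos (2 * pi * u) by have := cos_geN1 (2 * pi * u); lra.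
have mean_ge (d : R) n : 0 < d < 1 / 2 ->
    d / 2 * (1 + cos (2 * pi * (d / 2))) ^+ n <= cosmean (s n).
  move=> /andP[d0 d1]; set r := _ ^+ n.
  have td : torus R (d / 2) by apply/andP; split; lra.
  (* A step function below the power on the torus, since cosine decreases on the first piece. *)
  pose g (t : R) : R := if t < d / 2 then r else 0.
  have [ig Ig] : integrable1 g /\ int1 g = r * (d / 2) - r * 0 + (0 - 0).
    apply: (@int1_piecewise _ _ g (fun=> r) (fun=> 0) (fun t => r * t) (fun=> 0)) => //.
    - by move=> x; exact: cvg_cst.
    - by move=> x; exact: cvg_cst.
    - move=> x; rewrite -[X in is_derive _ _ _ X]mulr1; exact: is_deriveZ.
    - by move=> x /andP[_ xd]; rewrite /g xd.
    - by move=> x /andP[xd _]; rewrite /g ltNge xd.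
  have ic : integrable1 (cossum (s n)).
    apply: continuous_integrable1.
    have -> : cossum (s n) = trigsum [seq (a.1, 2 * pi * a.2%:R, pi / 2) | a <- s n].
      apply/funext => t; rewrite /cossum /trigsum big_map.
      by apply: eq_bigr => a _ /=; rewrite sinDpihalf.
    exact: continuous_trigsum.
  rewrite -cosmean_int1 mulrC.
  have -> : r * (d / 2) = int1 g by rewrite Ig mulr0 !subr0 addr0.
  apply: le_Rintegral => //; first exact: measurable_torus.
  move=> t /andP[t0 t1]; rewrite /= -[X in _ <= X](sE n t) /g; case: ltP => [td2|_]; last exact: exprn_ge0.
  rewrite lerXn2r ?nnegrE // lerD2l.
  have [->|t_neq0] := eqVneq t 0; first by rewrite mulr0 cos0 cos_le1.
  have t_gt0 : 0 < t by rewrite lt_def t_neq0.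
  by apply/ltW/coslt => //; lra.
have r_gt1 (d : R) : 0 < d < 1 / 2 -> 1 + cos (2 * pi * d) < 1 + cos (2 * pi * (d / 2)) :> R.
  move=> /andP[d0 d1]; rewrite ltrD2l.
  by apply: coslt; lra.
have A_gt0 n : 0 < cosmean (s n).
  have d4 : 0 < (1 / 4 : R) < 1 / 2 by apply/andP; split; lra.
  apply: lt_le_trans (mean_ge _ n d4); apply: mulr_gt0; first by lra.
  by apply: exprn_gt0; exact: le_lt_trans (base0 _) (r_gt1 _ d4).
pose phi n := trigsum (sawtest (s n)).
pose D n u : R := 1 - trigsum (dtrig (sawtest (s n))) u.
have DE n u : D n u = (1 + cos (2 * pi * u)) ^+ n / cosmean (s n).
  by rewrite /D dtrig_sawtest ?gt_eqF // -sE opprB addrC subrK.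
exists phi, D; split.
- by move=> n c; rewrite /phi trigsum_shift; exact: smooth_trigsum.
- by move=> n u; rewrite !DE cos2pi1; split; first exact: trigsum_sawtest1.
- by move=> n u; rewrite /D opprB addrC subrK; exact: is_derive_trigsum.
- move=> n; split=> [u|u].
    by apply: cvgB; [exact: cvg_cst | exact: continuous_trigsum].
  by rewrite DE divr_ge0 ?exprn_ge0 // ltW.
- split=> [n|n|d e dd e0]; [exact: trigsum_sawtest0 | exact: trigsum_sawtest_half |].
  have [d0 d1] := andP dd.
  set q := 1 + cos (2 * pi * d); set r := 1 + cos (2 * pi * (d / 2)).
  have qr : q < r by exact: r_gt1.
  have r0 : 0 < r by exact: le_lt_trans (base0 _) qr.
  have q0 : 0 <= q by exact: base0.
  have : (fun n => (q / r) ^+ n) @ \oo --> (0 : R).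
    by apply: cvg_expr; rewrite ger0_norm ?divr_ge0 ?(ltW r0) // ltr_pdivrMr // mul1r.
  move=> /cvgrPdist_lt /(_ (e * (d / 2)) (mulr_gt0 e0 _)) [|M _ HM]; first by lra.
  exists M => n u Mn du; rewrite DE ler_pdivrMr //.
  apply: (@le_trans _ _ (q ^+ n)).
    rewrite lerXn2r ?nnegrE // lerD2l; apply: cosle => //.
    by apply/andP; split; lra.
  apply: (@le_trans _ _ (e * (d / 2 * r ^+ n))).
    have := HM n Mn; rewrite /= sub0r normrN ger0_norm ?exprn_ge0 ?divr_ge0 ?(ltW r0) //.
    by rewrite expr_div_n ltr_pdivrMr ?exprn_gt0 // (mulrA e (d / 2)) => /ltW.
  by rewrite ler_pM2l //; exact: mean_ge.
Qed.

End ApproximateIdentity.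

(** * Passing to the limit in the weak derivative *)

Section Reproducing.
Local Open Scope classical_set_scope.
Local Open Scope ring_scope.

Lemma Rintegral_dominated d (T : measurableType d) (R : realType)
    (mu : {measure set T -> \bar R}) (D : set T) (f_ : nat -> T -> R) (f g : T -> R) :
  measurable D -> (forall n, measurable_fun D (f_ n)) -> measurable_fun D f ->
  mu.-integrable D (EFin \o g) ->
  (forall n x, D x -> `|f_ n x| <= g x) ->
  (\forall x \ae mu, D x -> (fun n => f_ n x) @ \oo --> f x) ->
  (fun n => Rintegral mu D (f_ n)) @ \oo --> Rintegral mu D f.
Proof.
move=> mD mf_ mf ig fg cf.
have [] := @dominated_convergence _ _ _ mu D mD (fun n => EFin \o f_ n) (EFin \o f) (EFin \o g).
- by move=> n; apply/measurable_EFinP.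
- exact/measurable_EFinP.
- apply: filterS cf => x fx Dx; apply: cvg_EFin; last exact: fx.
  exact: nearW.
- by [].
- by apply: aeW => x n Dx; rewrite /= lee_fin; exact: fg.
move=> fi _ cv; apply: fine_cvg; rewrite fineK //.
exact: integrable_fin_num.
Qed.

Variable R : realType.
Implicit Types (u c : R).

(* [sawtooth c] is, on the torus, the derivative of the periodic function t |-> k(|t - c|). *)
Definition sawtooth c (t : R) : R := t - c - 1 / 2 + (t < c)%R%:R.

Lemma measurable_sawtooth c : measurable_fun (torus R : set (measurableTypeR R)) (sawtooth c).
Proof.
apply: measurable_funD.
  have cs : continuous (fun t : R => t - c - 1 / 2).
    by move=> x; apply: cvgB; [apply: cvgB; [exact: cvg_id | exact: cvg_cst] | exact: cvg_cst].
  exact: measurable_funS (continuous_measurable_fun cs).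
have -> : (fun t : R => (t < c)%R%:R) = \1_(`]-oo, c[%classic) :> (R -> R).
  apply/funext => t; rewrite indicE; congr (nat_of_bool _)%:R.
  by apply/idP/idP; rewrite inE /= in_itv.
by apply: measurable_indic; exact: measurable_itv.
Qed.

Lemma sawtooth_le1 c t : torus R c -> torus R t -> `|sawtooth c t| <= 1.
Proof.
move=> /andP[c0 c1] /andP[t0 t1]; rewrite /sawtooth ler_norml.
by case: ltP => h /=; apply/andP; split; lra.
Qed.

Lemma sawtooth_square_integrable c : torus R c -> square_integrable (sawtooth c).
Proof.
move=> tc; split; first exact: measurable_sawtooth.
have i1 : integrable1 (fun=> 1 : R) by apply: continuous_integrable1 => x; exact: cvg_cst.
apply: le_integrable i1 => //; first exact: measurable_torus.
  by apply/measurable_EFinP; apply: measurable_funX; exact: measurable_sawtooth.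
move=> x tx; rewrite /= lee_fin normr1 normrX exprn_ile1 //; exact: sawtooth_le1.
Qed.

Lemma h1_saw (f : H1 R) c : torus R c ->
  int1 (fun t => h1_der f t * sawtooth c t) = f c - int1 f.
Proof.
move=> tc; have [c0 c1] := andP tc.
have [phi [D [sm per der Dpos [phi0 phih conc]]]] := @saw_tests R.
have lip n a b : a <= b -> exists2 x, a <= x <= b & phi n b - phi n a = (1 - D n x) * (b - a).
  move=> ab.
  have cphi : {within `[a, b], continuous (phi n)}.
    apply: continuous_subspaceT => x; apply: differentiable_continuous.
    by apply/derivable1_diffP; case: (der n x).
  have [x] := MVT_segment ab (fun x _ => der n x) cphi.
  by rewrite in_itv /= => xab e; exists x.
have phi1 n : phi n 1 = 0 by rewrite -[1]add0r (per n 0).1.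
(* As D >= 0, the slope of phi is at most 1: the zero at 0 bounds phi from above, the zero at 1 from
   below. *)
have bnd01 n u : 0 <= u <= 1 -> `|phi n u| <= 1.
  move=> /andP[u0 u1]; rewrite ler_norml.
  have [x _] := lip n 0 u u0; rewrite phi0 !subr0 => ex.
  have [y _] := lip n u 1 u1; rewrite phi1 sub0r => e.
  have Dx := (Dpos n).2 x; have Dy := (Dpos n).2 y.
  by apply/andP; split; nra.
have bnd n t : torus R t -> `|phi n (t - c)| <= 1.
  move=> /andP[t0 t1]; have [ct|tc'] := leP c t.
    by apply: bnd01; apply/andP; split; lra.
  by rewrite -(per n (t - c)).1; apply: bnd01; apply/andP; split; lra.
(* Away from the integers the slope of phi is eventually within e of 1, and phi vanishes at 1/2.
   Half the distance from u to the integers is a margin that contains both u and 1/2. *)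
have near_saw u : 0 < u < 1 -> (fun n => phi n u) @ \oo --> u - 1 / 2.
  move=> /andP[u0 u1]; apply/cvgrPdist_le => e e0.
  have [M HM] : exists M, forall n v, (M <= n)%N ->
      Num.min u (1 - u) / 2 <= v <= 1 - Num.min u (1 - u) / 2 -> D n v <= e.
    by apply: conc => //; case: (leP u (1 - u)) => _; apply/andP; split; lra.
  exists M => // n Mn /=.
  have lipe a b : Num.min u (1 - u) / 2 <= a -> a <= b -> b <= 1 - Num.min u (1 - u) / 2 ->
      0 <= (b - a) - (phi n b - phi n a) <= e * (b - a).
    move=> ua ab bu; have [x /andP[ax xb] ->] := lip n a b ab.
    have Dx := (Dpos n).2 x.
    have De : D n x <= e by apply: HM => //; apply/andP; split; lra.
    by apply/andP; split; nra.
  have [mu0 mu1 mu2] : [/\ Num.min u (1 - u) / 2 <= u, Num.min u (1 - u) / 2 <= 1 / 2 &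
      Num.min u (1 - u) <= 1 - u].
    by case: (leP u (1 - u)) => ?; split; lra.
  have mu3 : u <= 1 - Num.min u (1 - u) / 2 by lra.
  have mu4 : 1 / 2 <= 1 - Num.min u (1 - u) / 2 by lra.
  rewrite ler_norml; have [uh|/ltW uh] := leP u (1 / 2).
    by have /andP[] := lipe _ _ mu0 uh mu4; rewrite phih => *; apply/andP; split; nra.
  by have /andP[] := lipe _ _ mu1 uh mu3; rewrite phih => *; apply/andP; split; nra.
have dphi n (t : R) : is_derive t 1 (fun t : R => phi n (t - c)) (1 - D n (t - c)).
  have d1 : is_derive t 1 (fun t : R => t - c) 1.
    by rewrite -[X in is_derive _ _ _ X]subr0; apply: is_deriveB.
  by rewrite -[1 - _]mulr1; exact: (@is_derive1_comp _ (phi n) _ _ _ _ (der n _) d1).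
have cphi n : continuous (fun t => phi n (t - c)).
  move=> x; apply: differentiable_continuous.
  by apply/derivable1_diffP; case: (dphi n x).
have cD n : continuous (fun t => D n (t - c)).
  move=> x; apply: (@continuous_comp _ _ _ (fun t : R => t - c) (D n)); last exact: (Dpos n).1.
  by apply: cvgB; [exact: cvg_id | exact: cvg_cst].
have intD n : int1 (fun t => D n (t - c)) = 1.
  have t0 : torus R 0 by rewrite /torus /= lexx ltr01.
  have dF (t : R) : is_derive t 1 (fun t : R => t - phi n (t - c)) (D n (t - c)).
    have -> : D n (t - c) = 1 - (1 - D n (t - c)) by ring.
    by apply: is_deriveB.
  have [_ ->] := int1_piecewise t0 (cD n) (cD n) dF dF (fun _ _ => erefl) (fun _ _ => erefl).
  have -> : phi n (1 - c) = phi n (0 - c) by rewrite -(per n (0 - c)).1; congr phi; ring.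
  by ring.
have ifD n : integrable1 (fun t => f t * D n (t - c)).
  by apply: continuous_integrable1 => x; exact: cvgM (@h1_continuous _ f x) (cD n x).
have if0 : integrable1 f by apply: continuous_integrable1; exact: (@h1_continuous _ f).
have test n : int1 (fun t => f t * D n (t - c)) =
    int1 f + int1 (fun t => h1_der f t * phi n (t - c)).
  have pn : periodic1 (fun t : R => phi n (t - c)) by move=> t; rewrite addrAC (per n _).1.
  have := h1_weak f pn (sm n c).
  rewrite (_ : int1 (fun x => f x * _) = int1 f + -1 * int1 (fun t => f t * D n (t - c))).
    by lra.
  rewrite -int1Z // -int1D //; last exact: integrable1Z.
  apply: eq_int1 => t _; rewrite derive1E.
  by case: (dphi n t) => _ ->; ring.
have lim1 : (fun n => int1 (fun t => h1_der f t * phi n (t - c))) @ \oo -->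
    int1 (fun t => h1_der f t * sawtooth c t).
  have [mg _] := h1_der_L2 f.
  have ig : integrable1 (h1_der f).
    have s1 : square_integrable (fun=> 1 : R).
      by apply: continuous_square_integrable => x; exact: cvg_cst.
    apply: eq_integrable1 (square_integrable_mul (h1_der_L2 f) s1) => x _.
    by rewrite mulr1.
  apply: (@Rintegral_dominated _ _ _ (leb R) _ (fun n t => h1_der f t * phi n (t - c)) _
    (fun t => `|h1_der f t|)).
  - exact: measurable_torus.
  - move=> n; apply: measurable_funM => //.
    exact: measurable_funS (continuous_measurable_fun (cphi n)).
  - by apply: measurable_funM => //; exact: measurable_sawtooth.
  - by have := integrable_abse ig.
  - by move=> n x tx; rewrite normrM ler_piMr // bnd.
  (* At t = c the limit is 0 but the sawtooth is -1/2, so one point has to be excepted. *)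
  - exists [set c]; split; [exact: measurable_set1 | exact: lebesgue_measure_set1 |].
    move=> t /= H; apply: contrapT => tc'; apply: H => /andP[t0 t1].
    apply: cvgM; first exact: cvg_cst.
    rewrite /sawtooth; have [tlt|tgt|//] := ltgtP t c; rewrite /=.
      rewrite (_ : (fun n => _) = (fun n => phi n (t - c + 1))); last first.
        by apply/funext => n; rewrite (per n _).1.
      rewrite (_ : _ - 1 / 2 + _ = t - c + 1 - 1 / 2); last by rewrite /=; ring.
      by apply: near_saw; apply/andP; split; lra.
    by rewrite addr0; apply: near_saw; apply/andP; split; lra.
have lim2 : (fun n => int1 (fun t => f t * D n (t - c))) @ \oo --> f c.
  apply/cvgrPdist_le => e e0.
  have e2 : 0 < e / 2 by lra.
  have [d /andP[d0 d1] Hd] : exists2 d, 0 < d < 1 / 2 &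
      forall t, `|t - c| < d -> `|f t - f c| <= e / 2.
    have := @h1_continuous _ f c; move=> /cvgrPdist_le /(_ _ e2) /nbhs_ballP[d /= d0 Hd].
    exists (Num.min d (1 / 4)) => [|t].
      by case: (leP d (1 / 4)) => ?; apply/andP; split; lra.
    rewrite lt_min => /andP[td _]; rewrite distrC; apply: Hd.
    by rewrite /ball /= distrC.
  have [b b01 Hb] : exists2 b, b \in `[0, 1]%R & forall t, t \in `[0, 1]%R ->
      `|f t - f c| <= `|f b - f c|.
    apply: (@EVT_max _ (fun t => `|f t - f c|)); first exact: ler01.
    apply: continuous_subspaceT => x; apply: cvg_norm.
    by apply: cvgB; [exact: (@h1_continuous _ f) | exact: cvg_cst].
  set B := `|f b - f c| in Hb.
  have B0 : 0 <= B by exact: normr_ge0.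
  (* [B] may be 0, for constant f; adding 1 makes it a legitimate divisor. *)
  have B1 : 0 < B + 1 by lra.
  have dd : 0 < d < 1 / 2 by apply/andP.
  have [M HM] := conc d (e / 2 / (B + 1)) dd (divr_gt0 e2 B1).
  exists M => // n Mn /=.
  have i2 : integrable1 (fun t => e / 2 * D n (t - c) + e / 2).
    apply: continuous_integrable1 => x; apply: cvgD; last exact: cvg_cst.
    by apply: cvgM; [exact: cvg_cst | exact: cD].
  have i1 : integrable1 (fun t => (f t - f c) * D n (t - c)).
    apply: continuous_integrable1 => x; apply: cvgM; last exact: cD.
    by apply: cvgB; [exact: (@h1_continuous _ f) | exact: cvg_cst].
  have iD : integrable1 (fun t => D n (t - c)) by exact: continuous_integrable1.
  have -> : f c - int1 (fun t => f t * D n (t - c)) = - int1 (fun t => (f t - f c) * D n (t - c)).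
    rewrite (_ : int1 (fun t => (f t - f c) * _) =
      int1 (fun t => f t * D n (t - c) + (- f c) * D n (t - c))); last first.
      by apply: eq_int1 => t _; ring.
    rewrite int1D ?int1Z ?intD //; first by ring.
    exact: integrable1Z.
  rewrite normrN; rewrite /int1; apply: le_trans (le_normr_Rintegral (@measurable_torus R) i1) _.
  have -> : e = int1 (fun t => e / 2 * D n (t - c) + e / 2).
    have iB : integrable1 (fun=> e / 2) by apply: continuous_integrable1 => x; exact: cvg_cst.
    by rewrite (int1D (integrable1Z (e / 2) iD) iB) int1Z // intD int1_cst; lra.
  apply: le_Rintegral => //; first exact: measurable_torus.
    by have := integrable_abse i1.
  move=> t /andP[t0 t1].
  have D0 := (Dpos n).2 (t - c).
  rewrite normrM (ger0_norm D0).
  have near_c : `|f t - f c| <= e / 2 -> `|f t - f c| * D n (t - c) <= e / 2 * D n (t - c) + e / 2.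
    by move=> h; nra.
  have far_c : D n (t - c) <= e / 2 / (B + 1) ->
      `|f t - f c| * D n (t - c) <= e / 2 * D n (t - c) + e / 2.
    move=> h.
    have hB : `|f t - f c| <= B by apply: Hb; rewrite in_itv /= t0 ltW.
    have : (B + 1) * D n (t - c) <= e / 2 by rewrite mulrC -ler_pdivlMr //; lra.
    by have := normr_ge0 (f t - f c); nra.
  (* Nearness is on the circle, so t, t + 1 and t - 1 are compared with c. If all are far, t - c or
     t - c + 1 lies between d and 1 - d. *)
  have [h1|h1] := ltP `|t - c| d; first by apply: near_c; exact: Hd.
  have [h2|h2] := ltP `|t + 1 - c| d.
    by apply: near_c; rewrite -(h1_periodic f t); exact: Hd.
  have [h3|h3] := ltP `|t - 1 - c| d.
    by apply: near_c; rewrite -(subrK 1 t) (h1_periodic f); exact: Hd.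
  apply: far_c; have [ct|ct] := leP c t.
    apply: HM => //; move: h1 h3.
    rewrite ger0_norm; last by lra.
    rewrite ltr0_norm; last by lra.
    by move=> *; apply/andP; split; lra.
  rewrite -(per n (t - c)).2; apply: HM => //; move: h1 h2.
  rewrite ltr0_norm; last by lra.
  rewrite ger0_norm; last by lra.
  by move=> *; apply/andP; split; lra.
have lim3 : (fun n => int1 f + int1 (fun t => h1_der f t * phi n (t - c))) @ \oo -->
    int1 f + int1 (fun t => h1_der f t * sawtooth c t).
  by apply: cvgD lim1; exact: cvg_cst.
rewrite -(funext test) in lim3.
have -> : f c = int1 f + int1 (fun t => h1_der f t * sawtooth c t).
  by apply: (cvg_unique _ lim2 lim3).
by rewrite addrC addKr.
Qed.

End Reproducing.

(** * Kernel sections as periodic functions with a weak derivative *)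

Section KernelElement.
Local Open Scope classical_set_scope.
Local Open Scope ring_scope.
Variables (R : realType) (gamma : R).
Implicit Types (u c : R).

Let is_derive_cubic (a b c d x : R) :
  is_derive x 1 (fun t : R => a * t ^+ 3 + b * t ^+ 2 + c * t + d)
    (a * (3 * x ^+ 2) + b * (2 * x) + c).
Proof.
have := is_derive_poly (a *: 'X^3 + b *: 'X^2 + c *: 'X + d%:P) x.
have -> : horner (a *: 'X^3 + b *: 'X^2 + c *: 'X + d%:P) =
    (fun t : R => a * t ^+ 3 + b * t ^+ 2 + c * t + d).
  by apply/funext => t; rewrite !hornerE.
move=> h; apply: (is_derive_eq h).
rewrite !derivD !derivZ !derivXn derivX derivC /= addr0 !hornerD !hornerZ !hornerMn !hornerXn hornerC.
by ring.
Qed.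

Let is_derive_shift (F : R -> R) (c x df : R) : is_derive (x + c) 1 F df ->
  is_derive x 1 (fun t : R => F (t + c)) df.
Proof.
move=> dF.
have d1 : is_derive x 1 (fun t : R => t + c) 1.
  by rewrite -[X in is_derive _ _ _ X]addr0; apply: is_deriveD.
by rewrite -[df]mulr1; exact: (@is_derive1_comp _ F (fun t : R => t + c) x df 1 dF d1).
Qed.

Let is_derive_cont (f : R -> R) (df : R -> R) :
  (forall x : R, is_derive x 1 f (df x)) -> continuous f.
Proof.
move=> d x; apply: differentiable_continuous; apply/derivable1_diffP.
by case: (d x).
Qed.

Lemma is_derive_torus_kernel (x : R) :
  is_derive x 1 (torus_kernel gamma) (gamma * (x - 1 / 2)).
Proof.
have := is_derive_cubic 0 (gamma / 2) (- (gamma / 2)) (1 + gamma / 12) x.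
rewrite (_ : (fun t => _) = torus_kernel gamma); last first.
  by apply/funext => t; rewrite /torus_kernel; field.
by move=> h; apply: (is_derive_eq h); field.
Qed.

Lemma mod1_torus (z : R) : torus R (mod1 z).
Proof.
rewrite /torus /mod1 /=; have := floor_itv z; rewrite intrD rmorph1.
by move=> /andP[h1 h2]; apply/andP; split; lra.
Qed.

Lemma mod1_small (w : R) : torus R w -> mod1 w = w.
Proof. by move=> tw; apply: (@mod1_eq _ _ _ 0) => //; rewrite addr0. Qed.

Lemma mod1D1 (z : R) : mod1 (z + 1) = mod1 z.
Proof.
apply: (@mod1_eq _ _ _ (Num.floor z + 1)); first exact: mod1_torus.
by rewrite intrD rmorph1 /mod1; ring.
Qed.

Lemma mod1_sub_torus c t : torus R c -> torus R t -> mod1 (t - c) = t - c + (t < c)%R%:R.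
Proof.
move=> /andP[c0 c1] /andP[t0 t1]; case: ltP => tc /=.
  by rewrite -mod1D1 mod1_small //; apply/andP; split; lra.
by rewrite addr0 mod1_small //; apply/andP; split; lra.
Qed.

Definition periodic_kernel c t := torus_kernel gamma (mod1 (t - c)).

(** By the symmetry t -> 1 - t of the kernel, the fractional part of t - c may be replaced by |t -
    c|. *)
Lemma periodic_kernelE c t : torus R c -> torus R t ->
  periodic_kernel c t = torus_kernel gamma `|t - c|.
Proof.
move=> tc tt; rewrite /periodic_kernel mod1_sub_torus //.
case: ltrP => h; last by rewrite addr0.
by rewrite /torus_kernel; congr (_ + gamma * (_ / 2)); rewrite /=; ring.
Qed.

(** [mod1] jumps at the integers, but z (1 - z) vanishes at 0 and 1 and has slope at most 1 in
    between, so its periodic extension is Lipschitz. The bound w < z + 1 allows at most one wrap. *)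
Let parabola_lip (z w : R) : z <= w -> w < z + 1 ->
  `|(mod1 z) * (1 - mod1 z) - (mod1 w) * (1 - mod1 w)| <= w - z.
Proof.
move=> zw wz; have /andP[z0 z1] := mod1_torus z.
have [h|h] := ltP (mod1 z + (w - z)) 1.
  have -> : mod1 w = mod1 z + (w - z).
    apply: (@mod1_eq _ _ _ (Num.floor z)); first by apply/andP; split; lra.
    by rewrite /mod1; ring.
  by rewrite ler_norml; apply/andP; split; nra.
have -> : mod1 w = mod1 z + (w - z) - 1.
  apply: (@mod1_eq _ _ _ (Num.floor z + 1)); first by apply/andP; split; lra.
  by rewrite intrD rmorph1 /mod1; ring.
by rewrite ler_norml; apply/andP; split; nra.
Qed.

Lemma continuous_periodic_kernel c : continuous (periodic_kernel c).
Proof.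
have cp : continuous (fun z : R => mod1 z * (1 - mod1 z)).
  move=> x; apply/cvgrPdist_le => e e0; apply/nbhs_ballP.
  exists (Num.min e 1) => [|t]; first by rewrite /= lt_min e0 ltr01.
  rewrite /ball /= lt_min => /andP[/ltW xe x1].
  have [xt|tx] := leP x t.
    apply: le_trans (parabola_lip xt _) _; move: x1 xe; rewrite distrC ger0_norm; lra.
  rewrite distrC; apply: le_trans (parabola_lip (ltW tx) _) _;
    move: x1 xe; rewrite gtr0_norm; lra.
have -> : periodic_kernel c = (fun t => (1 + gamma / 12) -
    gamma / 2 * (fun z : R => mod1 z * (1 - mod1 z)) (t - c)).
  by apply/funext => t; rewrite /periodic_kernel /torus_kernel; field.
move=> x; apply: cvgB; first exact: cvg_cst.
apply: cvgM; first exact: cvg_cst.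
apply: (@continuous_comp _ _ _ (fun t : R => t - c) (fun z : R => mod1 z * (1 - mod1 z))); last exact: cp.
by apply: cvgB; [exact: cvg_id | exact: cvg_cst].
Qed.

Lemma periodic_kernel_periodic c : periodic1 (periodic_kernel c).
Proof. by move=> t; rewrite /periodic_kernel addrAC mod1D1. Qed.

Lemma sawtooth_kernel_square_integrable c : torus R c ->
  square_integrable (fun t => gamma * sawtooth c t).
Proof.
move=> tc; have [m i] := sawtooth_square_integrable tc; split.
  by apply: measurable_funM => //; exact: measurable_cst.
apply: eq_integrable1 (integrable1Z (gamma ^+ 2) i) => x _ /=.
by rewrite exprMn.
Qed.

Let piece_lt c t : torus R c -> 0 <= t < c ->
  mod1 (t - c) = t + (1 - c) /\ sawtooth c t = t + (1 - c) - 1 / 2.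
Proof.
move=> tc /andP[t0 tlt]; have [c0 c1] := andP tc.
rewrite mod1_sub_torus ?tlt //; last by apply/andP; split; lra.
by rewrite /sawtooth tlt; split; rewrite /=; ring.
Qed.

Let piece_ge c t : torus R c -> c <= t < 1 ->
  mod1 (t - c) = t + - c /\ sawtooth c t = t + - c - 1 / 2.
Proof.
move=> tc /andP[ct t1]; have [c0 c1] := andP tc.
rewrite mod1_sub_torus //; last by apply/andP; split; lra.
by rewrite /sawtooth ltNge ct; split; rewrite /= addr0.
Qed.

(** On either side of c the product of kernel and phi is an antiderivative. Its boundary values
    cancel: at c because k(0) = k(1), at 0 and 1 by periodicity. *)
Lemma periodic_kernel_weak c : torus R c ->
  weak_derivative (periodic_kernel c) (fun t => gamma * sawtooth c t).
Proof.
move=> tc phi per sm; have [c0 c1] := andP tc.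
have dphi (x : R) : is_derive x 1 phi (derive1 phi x).
  by rewrite derive1E; apply: derivableP; exact: (sm 0%N x).
have dphi' (x : R) : is_derive x 1 (derive1 phi) (derive1 (derive1 phi) x).
  by rewrite [derive1 (derive1 phi) x]derive1E; apply: derivableP; exact: (sm 1%N x).
have cphi := is_derive_cont dphi; have cphi' := is_derive_cont dphi'.
have dP a (x : R) : is_derive x 1 (fun t : R => torus_kernel gamma (t + a) * phi t)
    (torus_kernel gamma (x + a) * derive1 phi x + gamma * (x + a - 1 / 2) * phi x).
  have d1 : is_derive x 1 (fun t : R => torus_kernel gamma (t + a)) (gamma * (x + a - 1 / 2)).
    exact/is_derive_shift/is_derive_torus_kernel.
  by rewrite [X in _ + X]mulrC; exact: (is_deriveM d1 (dphi x)).
have ck := is_derive_cont is_derive_torus_kernel.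
have cK a : continuous (fun t : R => torus_kernel gamma (t + a)).
  by apply: is_derive_cont => x; exact/is_derive_shift/is_derive_torus_kernel.
have cP a : continuous (fun x => torus_kernel gamma (x + a) * derive1 phi x +
    gamma * (x + a - 1 / 2) * phi x).
  move=> x; apply: cvgD; apply: cvgM; [exact: cK | exact: cphi' | | exact: cphi].
  apply: cvgM; first exact: cvg_cst.
  by apply: cvgB; [apply: cvgD; [exact: cvg_id | exact: cvg_cst] | exact: cvg_cst].
have [i I] := @int1_piecewise _ c (fun t => periodic_kernel c t * derive1 phi t +
    gamma * sawtooth c t * phi t) _ _ _ _ tc (cP (1 - c)) (cP (- c)) (dP (1 - c)) (dP (- c))
    (fun x h => ltac:(by have [e1 e2] := piece_lt tc h; rewrite /periodic_kernel e1 e2))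
    (fun x h => ltac:(by have [e1 e2] := piece_ge tc h; rewrite /periodic_kernel e1 e2)).
have i1 : integrable1 (fun t => periodic_kernel c t * derive1 phi t).
  apply: continuous_integrable1 => x; apply: cvgM; last exact: cphi'.
  exact: continuous_periodic_kernel.
have i2 : integrable1 (fun t => gamma * sawtooth c t * phi t).
  apply: square_integrable_mul; first exact: sawtooth_kernel_square_integrable.
  exact: continuous_square_integrable.
apply/eqP; rewrite -subr_eq0 opprK -int1D // I.
have -> : phi 1 = phi 0 by rewrite -(per 0) add0r.
by apply/eqP; rewrite /torus_kernel; field.
Qed.

Lemma int1_periodic_kernel c : torus R c -> int1 (periodic_kernel c) = 1.
Proof.
move=> tc; pose Q (u : R) := gamma / 6 * u ^+ 3 + - (gamma / 4) * u ^+ 2 + (1 + gamma / 12) * u + 0.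
have dQ a (x : R) : is_derive x 1 (fun t : R => Q (t + a)) (torus_kernel gamma (x + a)).
  apply: is_derive_shift; have := is_derive_cubic (gamma / 6) (- (gamma / 4)) (1 + gamma / 12) 0 (x + a).
  by move=> h; apply: (is_derive_eq h); rewrite /torus_kernel; field.
have cK a : continuous (fun t : R => torus_kernel gamma (t + a)).
  by apply: is_derive_cont => x; exact/is_derive_shift/is_derive_torus_kernel.
have [_ ->] := @int1_piecewise _ c (periodic_kernel c) _ _ _ _ tc (cK (1 - c)) (cK (- c))
    (dQ (1 - c)) (dQ (- c))
    (fun x h => ltac:(by have [e1 e2] := piece_lt tc h; rewrite /periodic_kernel e1))
    (fun x h => ltac:(by have [e1 e2] := piece_ge tc h; rewrite /periodic_kernel e1)).
by rewrite /Q; field.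
Qed.

End KernelElement.

Section ReproducingElements.
Local Open Scope classical_set_scope.
Local Open Scope ring_scope.

Definition kernel_element (R : realType) (gamma c : R) (tc : torus R c) : H1 R :=
  MkH1 (@periodic_kernel_periodic R gamma c) (@continuous_periodic_kernel R gamma c)
    (@sawtooth_kernel_square_integrable R gamma c tc) (@periodic_kernel_weak R gamma c tc).

Lemma kernel_element_reproducing (R : realType) (gamma c : R) (tc : torus R c) (f : H1 R) :
  gamma != 0 -> h1_dot gamma (kernel_element gamma tc) f = f c.
Proof.
move=> g0; rewrite /h1_dot /= int1_periodic_kernel // mul1r.
rewrite (_ : int1 (fun t => _ * _) = gamma * (f c - int1 f)); first by field.
rewrite -(h1_saw f tc) -int1Z; first by apply: eq_int1 => t _; ring.
by apply: square_integrable_mul; [exact: h1_der_L2 | exact: sawtooth_square_integrable].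
Qed.

Lemma one_weak (R : realType) : weak_derivative (fun=> 1 : R) (fun=> 0 : R).
Proof.
move=> phi per sm.
have dphi (x : R) : is_derive x 1 phi (derive1 phi x).
  by rewrite derive1E; apply: derivableP; exact: (sm 0%N x).
have dphi' (x : R) : is_derive x 1 (derive1 phi) (derive1 (derive1 phi) x).
  by rewrite [derive1 (derive1 phi) x]derive1E; apply: derivableP; exact: (sm 1%N x).
have cphi' : continuous (derive1 phi).
  move=> x; apply: differentiable_continuous; apply/derivable1_diffP.
  by case: (dphi' x).
have t0 : torus R 0 by rewrite /torus /= lexx ltr01.
have [_] := int1_piecewise t0 cphi' cphi' dphi dphi (fun _ _ => erefl) (fun _ _ => erefl).
have -> : phi 1 = phi 0 by rewrite -(per 0) add0r.
rewrite !subrr addr0 => e.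
rewrite (_ : int1 (fun x => 1 * _) = 0); last by rewrite -e; apply: eq_int1 => x _; rewrite mul1r.
rewrite (_ : int1 _ = 0) ?oppr0 //.
by rewrite -[RHS](int1_cst 0); apply: eq_int1 => x _; rewrite mul0r.
Qed.

Lemma continuous_constant (R : realType) (a : R) : continuous (fun _ : R => a).
Proof. by move=> x; exact: cvg_cst. Qed.

Definition one_element (R : realType) : H1 R :=
  @MkH1 R (fun=> 1) (fun=> 0) (fun _ => erefl) (@continuous_constant R 1)
    (continuous_square_integrable (@continuous_constant R 0)) (@one_weak R).

Lemma one_element_dot (R : realType) (gamma : R) (f : H1 R) :
  h1_dot gamma (one_element R) f = int1 f.
Proof.
rewrite /h1_dot /= int1_cst mul1r (_ : int1 (fun x => _ * _) = 0) ?mulr0 ?addr0 //.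
by rewrite -[RHS](int1_cst 0); apply: eq_int1 => x _; rewrite mul0r.
Qed.

End ReproducingElements.

(** * Tensors and the worst case error *)

Section TensorForm.
Local Open Scope classical_set_scope.
Local Open Scope ring_scope.
Variables (R : realType) (gamma : R).
Hypothesis gamma_gt0 : 0 < gamma.
Implicit Types (f g : H1 R) (s t : tensor R).

Let h1_der_integrable f g : integrable1 (fun x => h1_der f x * h1_der g x).
Proof. by apply: square_integrable_mul; exact: h1_der_L2. Qed.

Lemma h1_dotC f g : h1_dot gamma f g = h1_dot gamma g f.
Proof.
by rewrite /h1_dot mulrC; congr (_ + _ * _); apply: eq_int1 => x _; rewrite mulrC.
Qed.

(* Schur's product theorem: [h1_dot] is a sum of squares plus an integral of squares. *)
Lemma h1_dot_schur (T : Type) (r : seq T) (u : T -> H1 R) (q : T -> T -> R) (w : T -> R) :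
  (forall w, 0 <= \sum_(a <- r) \sum_(b <- r) w a * w b * q a b) ->
  0 <= \sum_(a <- r) \sum_(b <- r) w a * w b * (h1_dot gamma (u a) (u b) * q a b).
Proof.
move=> q0; set X := \sum_(a <- r) _.
pose S x := \sum_(a <- r) \sum_(b <- r)
  (w a * w b * q a b) * (h1_der (u a) x * h1_der (u b) x).
have -> : X = \sum_(a <- r) \sum_(b <- r) (w a * int1 (u a)) * (w b * int1 (u b)) * q a b
    + gamma^-1 * int1 S.
  rewrite int1_sum => [|a]; last first.
    by apply: integrable1_sum => b; exact: integrable1Z.
  rewrite mulr_sumr -big_split; apply: eq_bigr => a _ /=.
  rewrite int1_sum => [|b]; last exact: integrable1Z.
  rewrite mulr_sumr -big_split; apply: eq_bigr => b _ /=.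
  by rewrite int1Z // /h1_dot; ring.
apply: addr_ge0; first exact: q0.
apply: mulr_ge0; first by rewrite invr_ge0 ltW.
apply: Rintegral_ge0 => x _; rewrite /S.
have := q0 (fun a => w a * h1_der (u a) x); congr (_ <= _).
by apply: eq_bigr => a _; apply: eq_bigr => b _; ring.
Qed.

(** Schur's theorem is applied once per tensor factor, starting from the all-ones form. *)
Lemma tensor_dot_ge0 t : 0 <= tensor_dot gamma t t.
Proof.
have sq w : 0 <= \sum_(a <- t) \sum_(b <- t) w a * w b * 1 :> R.
  rewrite (eq_bigr (fun a => w a * \sum_(b <- t) w b)) => [|a _].
    by rewrite -mulr_suml -expr2 sqr_ge0.
  by rewrite mulr_sumr; apply: eq_bigr => b _; rewrite mulr1.
have h2 w : 0 <= \sum_(a <- t) \sum_(b <- t) w a * w b * h1_dot gamma a.2.2 b.2.2.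
  have := @h1_dot_schur _ t (fun a => a.2.2) _ w sq; congr (_ <= _).
  by apply: eq_bigr => a _; apply: eq_bigr => b _; rewrite mulr1.
exact: (@h1_dot_schur _ t (fun a => a.2.1) _ (fun a => a.1) h2).
Qed.

Lemma tensor_dotC s t : tensor_dot gamma s t = tensor_dot gamma t s.
Proof.
rewrite /tensor_dot exchange_big; apply: eq_bigr => a _; apply: eq_bigr => b _.
by rewrite (h1_dotC b.2.1) (h1_dotC b.2.2) (mulrC b.1).
Qed.

Definition tensor_scale (c : R) t : tensor R := [seq (c * a.1, a.2) | a <- t].

Lemma tensor_dot_cat s1 s2 t :
  tensor_dot gamma (s1 ++ s2) t = tensor_dot gamma s1 t + tensor_dot gamma s2 t.
Proof. by rewrite /tensor_dot big_cat. Qed.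

Lemma tensor_dot_scale c s t :
  tensor_dot gamma (tensor_scale c s) t = c * tensor_dot gamma s t.
Proof.
rewrite /tensor_dot big_map mulr_sumr; apply: eq_bigr => a _.
by rewrite mulr_sumr; apply: eq_bigr => b _ /=; rewrite !mulrA.
Qed.

Lemma tensor_subE s t : tensor_sub s t = s ++ tensor_scale (-1) t.
Proof. by congr (_ ++ _); apply: eq_map => a; rewrite mulN1r. Qed.

(** Formal tensors such as u - u have norm 0, so c = 0 has to be covered; then the affine function
    is nonnegative only if b = 0. *)
Let discriminant (a b c : R) : 0 <= c -> (forall l, 0 <= a + l * (2 * b) + l ^+ 2 * c) -> b ^+ 2 <= a * c.
Proof.
move=> c_ge0 pos; have a0 : 0 <= a by have := pos 0; rewrite mul0r expr0n /= mul0r !addr0.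
have [c0|c0] := eqVneq c 0.
  have [->|b0] := eqVneq b 0; first by rewrite c0 expr0n mulr0.
  (* At this l the affine function a + 2 b l takes the value -1. *)
  have := pos (- (a + 1) / (2 * b)); rewrite c0 mulr0 addr0.
  by rewrite mulfVK ?mulf_neq0 ?pnatr_eq0 //; lra.
have := pos (- b / c).
have cp : 0 < c by rewrite lt_def c0.
have -> : a + - b / c * (2 * b) + (- b / c) ^+ 2 * c = (a * c - b ^+ 2) / c by field.
by rewrite pmulr_lge0 ?invr_gt0 // subr_ge0.
Qed.

Lemma tensor_cauchy_schwarz s t :
  `|tensor_dot gamma s t| <= tensor_norm gamma s * tensor_norm gamma t.
Proof.
rewrite -sqrtrM ?tensor_dot_ge0 // -sqrtr_sqr ler_sqrt; last first.
  by rewrite mulr_ge0 ?tensor_dot_ge0.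
rewrite mulrC; apply: discriminant => [|l]; first exact: tensor_dot_ge0.
have := tensor_dot_ge0 (t ++ tensor_scale l s).
rewrite tensor_dot_cat tensor_dot_scale !(tensor_dotC _ (_ ++ _)) !tensor_dot_cat.
rewrite !tensor_dot_scale (tensor_dotC t s); congr (_ <= _); ring.
Qed.

Definition tensor_mean t : R := \sum_(a <- t) a.1 * (int1 a.2.1 * int1 a.2.2).

Lemma tensor_dot_one t : tensor_dot gamma [:: (1, (one_element R, one_element R))] t = tensor_mean t.
Proof.
rewrite /tensor_dot big_seq1; apply: eq_bigr => b _ /=.
by rewrite mul1r !one_element_dot.
Qed.

Definition kernel_tensor (z : R * R) (tz : torus2 R z) : H1 R * H1 R :=
  (kernel_element gamma tz.1, kernel_element gamma tz.2).

Lemma tensor_dot_kernel (z : R * R) (tz : torus2 R z) c t :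
  tensor_dot gamma [:: (c, kernel_tensor tz)] t = c * tensor_eval t z.
Proof.
have g0 : gamma != 0 by rewrite gt_eqF.
rewrite /tensor_dot big_seq1 mulr_sumr; apply: eq_bigr => b _ /=.
by rewrite !kernel_element_reproducing // -mulrA.
Qed.

End TensorForm.

(** * Integration of tensors over the square *)

Section SquareIntegral.
Local Open Scope classical_set_scope.
Local Open Scope ring_scope.
Variable R : realType.
Implicit Types (u v : H1 R) (t : tensor R).
Local Notation mu2 := (leb R \x leb R)%E.
Local Notation T2 := (measurableTypeR R * measurableTypeR R)%type.

Lemma measurable_torus2 : measurable (torus2 R : set T2).
Proof. by apply: measurableX; exact: measurable_torus. Qed.

Lemma leb_torus2 : mu2 (torus2 R) = 1%E.
Proof.
rewrite product_measure1E; [|exact: measurable_torus|exact: measurable_torus].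
by rewrite -[LHS]/(leb R (torus R) * leb R (torus R))%E leb_torus mule1.
Qed.

Definition integrable2 (f : R * R -> R) := mu2.-integrable (torus2 R) (EFin \o f).

Lemma h1_bounded u : exists2 M, 0 <= M & forall x, torus R x -> `|u x| <= M.
Proof.
have [b _ Hb] : exists2 b, b \in `[0, 1]%R & forall y : R, y \in `[0, 1]%R -> `|u y| <= `|u b|.
  apply: (@EVT_max _ (fun y => `|u y|)); first exact: ler01.
  by apply: continuous_subspaceT => x; apply: cvg_norm; exact: (@h1_continuous _ u).
exists `|u b| => // x /andP[x0 x1]; apply: Hb.
by rewrite in_itv /= x0 ltW.
Qed.

Lemma measurable_h1_prod u v : measurable_fun (torus2 R : set T2) (fun z => u z.1 * v z.2).
Proof.
apply: measurable_funS (measurableT) _ _ => //.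
apply: measurable_funM.
  exact: (measurableT_comp (continuous_measurable_fun (@h1_continuous _ u)) measurable_fst).
exact: (measurableT_comp (continuous_measurable_fun (@h1_continuous _ v)) measurable_snd).
Qed.

Lemma bounded_integrable2 (f : R * R -> R) M :
  measurable_fun (torus2 R : set T2) f -> (forall z, torus2 R z -> `|f z| <= M) ->
  integrable2 f.
Proof.
move=> mf bf; apply: measurable_bounded_integrable => //.
- exact: measurable_torus2.
- by rewrite -[X in (X < _)%E]/(mu2 (torus2 R)) leb_torus2 ltry.
- exists M; split; first exact: num_real.
  by move=> y My z tz; apply: le_trans (bf z tz) (ltW My).
Qed.

Lemma h1_prod_integrable2 u v : integrable2 (fun z => u z.1 * v z.2).
Proof.
have [M M0 HM] := h1_bounded u; have [M' M'0 HM'] := h1_bounded v.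
apply: (@bounded_integrable2 _ (M * M')); first exact: measurable_h1_prod.
by move=> z [tz1 tz2]; rewrite normrM ler_pM // ?HM ?HM'.
Qed.

Lemma int2_h1_prod u v : int2 (fun z => u z.1 * v z.2) = int1 u * int1 v.
Proof.
have iu : integrable1 u by apply: continuous_integrable1; exact: (@h1_continuous _ u).
have iv : integrable1 v by apply: continuous_integrable1; exact: (@h1_continuous _ v).
have ifin f : integrable1 f -> (\int[leb R]_(x in torus R) (f x)%:E)%E = (int1 f)%:E.
  move=> fi; rewrite /int1 /Rintegral fineK //.
  exact: (integrable_fin_num (@measurable_torus R) fi).
rewrite /int2 /Rintegral integral_mkcond.
have i2 := h1_prod_integrable2 u v.
have i2' := (integrable_mkcond _ measurable_torus2).1 i2.
rewrite -integral12_prod_meas1 //.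
have e x : fubini_F (leb R) ((EFin \o (fun z => u z.1 * v z.2)) \_ (torus2 R)) x =
    ((fun x => (int1 v)%:E * (u x)%:E) \_ (torus R) x)%E.
  rewrite /fubini_F /patch.
  have [tx|ntx] := boolP (x \in torus R).
    rewrite (_ : (fun y => _) = (fun y => (u x)%:E * (v y)%:E) \_ (torus R))%E; last first.
      apply/funext => y; rewrite /patch.
      have -> : ((x, y) \in torus2 R) = (y \in torus R).
        by apply/idP/idP; rewrite !inE; [case | move=> ty; split => //=; rewrite inE in tx].
      by [].
    by rewrite -integral_mkcond integralZl // ?ifin // 1?muleC //; exact: measurable_torus.
  rewrite (_ : (fun y => _) = cst 0%E) ?integral0 //.
  apply/funext => y; case: ifPn => //; rewrite inE => -[/= tx _].
  by move: ntx; rewrite notin_setE.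
transitivity (fine (\int[leb R]_(x in torus R) ((int1 v)%:E * (u x)%:E))%E).
  by congr fine; rewrite [RHS]integral_mkcond; apply: eq_integral => x _; exact: e.
rewrite integralZl //; last exact: measurable_torus.
by rewrite ifin // -EFinM /= mulrC.
Qed.

Lemma measurable_tensor_eval t : measurable_fun (torus2 R : set T2) (tensor_eval t).
Proof.
rewrite (_ : tensor_eval t = fun z => \sum_(a <- t) a.1 * (a.2.1 z.1 * a.2.2 z.2)) //.
elim: t => [|a t IH].
  rewrite (_ : (fun z => _) = cst 0); first exact: measurable_cst.
  by apply/funext => z; rewrite big_nil.
rewrite (_ : (fun z => _) = (fun z => a.1 * (a.2.1 z.1 * a.2.2 z.2)) \+
  (fun z => \sum_(a <- t) a.1 * (a.2.1 z.1 * a.2.2 z.2))); last first.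
  by apply/funext => z; rewrite big_cons.
apply: measurable_funD => //; apply: measurable_funM; first exact: measurable_cst.
exact: measurable_h1_prod.
Qed.

Lemma int2_tensor_eval t : int2 (tensor_eval t) = tensor_mean t.
Proof.
suff [] : integrable2 (tensor_eval t) /\ int2 (tensor_eval t) = tensor_mean t by [].
elim: t => [|a t [IHi IH]].
  have -> : tensor_eval [::] = (fun=> 0 : R).
    by apply/funext => z; rewrite /tensor_eval big_nil.
  rewrite /int2 /tensor_mean big_nil; split; first exact: integrable0.
  by rewrite Rintegral_cst ?mul0r //; exact: measurable_torus2.
have -> : tensor_eval (a :: t) = (fun z => a.1 * (a.2.1 z.1 * a.2.2 z.2) + tensor_eval t z).
  by apply/funext => z; rewrite /tensor_eval big_cons.
have i1 := h1_prod_integrable2 a.2.1 a.2.2.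
have i1' := integrableZl measurable_torus2 a.1 i1.
split; first by have := integrableD (@measurable_torus2) i1' IHi.
rewrite /tensor_mean big_cons -/(tensor_mean t) -IH -int2_h1_prod /int2.
rewrite RintegralD //; last exact: measurable_torus2.
by rewrite RintegralZl //; exact: measurable_torus2.
Qed.

End SquareIntegral.

(** * The worst case error as the norm of its representer *)

Section WorstCaseError.
Local Open Scope classical_set_scope.
Local Open Scope ring_scope.
Variables (R : realType) (gamma : R).
Hypothesis gamma_gt0 : 0 < gamma.
Variables (N : nat) (P : 'I_N -> R * R).
Hypothesis N_gt0 : (0 < N)%N.
Hypothesis PP : point_set P.
Implicit Types (t : tensor R).

(* The Riesz representer of the negated integration error. *)
Definition error_tensor : tensor R :=
  (-1, (one_element R, one_element R)) ::
  [seq (N%:R^-1, kernel_tensor gamma (PP i)) | i <- enum 'I_N].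

Lemma tensor_dot_error t : tensor_dot gamma error_tensor t =
  N%:R^-1 * (\sum_(i < N) tensor_eval t (P i)) - tensor_mean t.
Proof.
rewrite /error_tensor -cat1s tensor_dot_cat.
have -> : [:: (-1, (one_element R, one_element R))] =
    tensor_scale (-1) [:: (1, (one_element R, one_element R))] by rewrite /tensor_scale /= mulr1.
rewrite tensor_dot_scale tensor_dot_one mulN1r addrC; congr (_ - _).
rewrite /tensor_dot big_map big_enum mulr_sumr; apply: eq_bigr => i _ /=.
by rewrite -(tensor_dot_kernel gamma_gt0 (PP i)) /tensor_dot big_seq1.
Qed.

Lemma tensor_dot_error_error : tensor_dot gamma error_tensor error_tensor =
  (\sum_(i < N) \sum_(j < N) torus_kernel gamma `|(P i).1 - (P j).1| *
     torus_kernel gamma `|(P i).2 - (P j).2|) / N%:R ^+ 2 - 1.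
Proof.
have N0 : N%:R != 0 :> R by rewrite pnatr_eq0 -lt0n.
(* Kernel sections and the constant 1 have the same mean, so the two parts cancel. *)
have me : tensor_mean error_tensor = 0.
  rewrite /tensor_mean big_cons big_map big_enum /= !int1_cst.
  rewrite (eq_bigr (fun=> N%:R^-1)) => [|i _]; last by rewrite !int1_periodic_kernel ?mulr1 //; case: (PP i).
  by rewrite sumr_const card_ord -[_ *+ N]mulr_natr mulVf // !mulr1 addrC subrr.
rewrite tensor_dot_error me subr0.
have ev i : tensor_eval error_tensor (P i) = -1 + N%:R^-1 *
    \sum_(j < N) torus_kernel gamma `|(P i).1 - (P j).1| * torus_kernel gamma `|(P i).2 - (P j).2|.
  rewrite /tensor_eval big_cons big_map big_enum /= !mulr1; congr (_ + _).
  rewrite mulr_sumr; apply: eq_bigr => j _.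
  by rewrite !periodic_kernelE //; [case: (PP j) | case: (PP i) | case: (PP j) | case: (PP i)].
rewrite (eq_bigr _ (fun i _ => ev i)) big_split /= sumr_const card_ord -mulr_sumr.
by rewrite -[_ *+ N]mulr_natr; field.
Qed.

Lemma kernel_tensor_norm (z : R * R) (tz : torus2 R z) :
  tensor_norm gamma [:: (1, kernel_tensor gamma tz)] = `|torus_kernel gamma 0|.
Proof.
rewrite /tensor_norm tensor_dot_kernel // mul1r /tensor_eval big_seq1 /= mul1r.
rewrite !periodic_kernelE //; try by case: tz.
by rewrite !subrr normr0 -expr2 sqrtr_sqr.
Qed.

(** The representer pairs with tensors only, so Cauchy-Schwarz is passed to the limit along the
    sequence defining f. Point values converge by definition; for the integral, the kernel turns
    bounded norms into a uniform bound that dominates. *)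
Lemma Hmix_norm_error f r : Hmix_norm gamma f r ->
  `|int2 f - N%:R^-1 * \sum_(i < N) f (P i)| <= tensor_norm gamma error_tensor * r.
Proof.
case=> t [_ cv cn].
have [B HB] : exists B, forall n, tensor_norm gamma (t n) <= B.
  have [|B [_ HB]] := @cvg_seq_bounded _ _ (fun n => tensor_norm gamma (t n)).
    by apply/cvg_ex; exists r.
  exists (B + 1) => n; apply: le_trans (ler_norm _) _.
  by apply: (HB (B + 1)) => //; rewrite ltrDl ltr01.
have B0 : 0 <= B := le_trans (sqrtr_ge0 _) (HB 0%N).
have bnd n z : torus2 R z -> `|tensor_eval (t n) z| <= `|torus_kernel gamma 0| * B.
  move=> tz; have := tensor_cauchy_schwarz gamma_gt0 [:: (1, kernel_tensor gamma tz)] (t n).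
  rewrite tensor_dot_kernel // mul1r kernel_tensor_norm => h.
  by apply: le_trans h _; rewrite ler_wpM2l.
have mean_cv : (fun n => tensor_mean (t n)) @ \oo --> int2 f.
  rewrite (_ : (fun n => _) = (fun n => int2 (tensor_eval (t n)))); last first.
    by apply/funext => n; rewrite int2_tensor_eval.
  rewrite /int2; apply: (@Rintegral_dominated _ _ _ (leb R \x leb R)%E (torus2 R) (fun n => tensor_eval (t n)) f
    (fun=> `|torus_kernel gamma 0| * B)) => //.
  - exact: measurable_torus2.
  - by move=> n; exact: measurable_tensor_eval.
  - by apply: (measurable_fun_cvg (fun n => measurable_tensor_eval (t n))) => z _; exact: cv.
  - apply: (@bounded_integrable2 _ (fun=> `|torus_kernel gamma 0| * B) `| `|torus_kernel gamma 0| * B |).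
      exact: measurable_cst.
    by [].
  - by apply: aeW => z _; exact: cv.
have sum_cv : (fun n => \sum_(i < N) tensor_eval (t n) (P i)) @ \oo --> \sum_(i < N) f (P i).
  by apply: cvg_big => [|i _]; [exact: add_continuous | exact: cv].
have dot_cv : (fun n => tensor_dot gamma error_tensor (t n)) @ \oo -->
    N%:R^-1 * \sum_(i < N) f (P i) - int2 f.
  rewrite (_ : (fun n => _) = (fun n => N%:R^-1 * (\sum_(i < N) tensor_eval (t n) (P i)) -
    tensor_mean (t n))); last by apply/funext => n; exact: tensor_dot_error.
  by apply: cvgB => //; apply: cvgM => //; exact: cvg_cst.
have abs_cv := cvg_norm dot_cv.
have norm_cv : (fun n => tensor_norm gamma error_tensor * tensor_norm gamma (t n)) @ \oo -->
    tensor_norm gamma error_tensor * r by apply: cvgM => //; exact: cvg_cst.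
rewrite distrC; apply: (ler_cvg_to (abs_cv _) norm_cv).
by apply: nearW => n; exact: tensor_cauchy_schwarz.
Qed.

Lemma Hmix_norm_tensor t : Hmix_norm gamma (tensor_eval t) (tensor_norm gamma t).
Proof.
exists (fun=> t); split; [|by move=> z; exact: cvg_cst|exact: cvg_cst].
move=> e e0; exists 0%N => _ _ _ _; rewrite /tensor_norm tensor_subE.
by rewrite tensor_dot_cat tensor_dot_scale mulN1r subrr sqrtr0.
Qed.

Lemma wceE : wce gamma P = (tensor_norm gamma error_tensor)%:E.
Proof.
have n0 : 0 <= tensor_norm gamma error_tensor by exact: sqrtr_ge0.
apply/eqP; rewrite eq_le; apply/andP; split.
  apply: ub_ereal_sup => _ [f [r [Hf r1 ->]]]; rewrite lee_fin.
  by apply: le_trans (Hmix_norm_error Hf) _; rewrite ler_piMr.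
set m := tensor_norm gamma error_tensor.
have mE : m ^+ 2 = tensor_dot gamma error_tensor error_tensor.
  by rewrite sqr_sqrtr // tensor_dot_ge0.
(* If m = 0 then m^-1 = 0, and this zero tensor still attains the supremum 0. *)
pose t := tensor_scale m^-1 error_tensor.
have dt : tensor_dot gamma error_tensor t = m.
  rewrite tensor_dotC tensor_dot_scale -mE.
  by have [->|m0] := eqVneq m 0; [rewrite expr0n mulr0 | rewrite expr2 mulKf].
apply: ereal_sup_ubound; exists (tensor_eval t), (tensor_norm gamma t); split.
- exact: Hmix_norm_tensor.
- rewrite /tensor_norm tensor_dot_scale dt.
  have [->|m0] := eqVneq m 0; first by rewrite mulr0 sqrtr0 ler01.
  by rewrite mulVf // sqrtr1.
- by rewrite int2_tensor_eval distrC -tensor_dot_error dt ger0_norm.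
Qed.

End WorstCaseError.

(** * Minimality and uniqueness of the lattice *)

Section LatticeMinimality.
Local Open Scope classical_set_scope.
Local Open Scope ring_scope.

Lemma ord_mulrn_inj n k : coprime n.+1 k -> injective (fun a : 'I_n.+1 => a *+ k).
Proof.
move=> co; suff le (a b : 'I_n.+1) : (a <= b)%N -> a *+ k = b *+ k -> a = b.
  move=> a b e; have [ab|/ltnW ba] := leqP a b; first exact: le.
  by apply/esym/le.
move=> ab /(congr1 (@nat_of_ord _)); rewrite !val_mulrn => /eqP.
rewrite eq_sym eqn_mod_dvd ?leq_mul2l ?ab ?orbT // -mulnBr Gauss_dvdr // => d.
apply/val_inj/eqP; rewrite eqn_leq ab /= -subn_eq0; apply: contraLR d => nz.
by rewrite gtnNdvd ?lt0n // (leq_ltn_trans (leq_subr _ _)).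
Qed.

Variables (R : realType) (gamma : R) (c : certificate) (n : nat).
Hypothesis gamma_gt0 : 0 < gamma.
Hypothesis gamma_le6 : gamma <= 6.
Hypothesis cNE : cN c = n.+1.
Hypothesis c_ok : check c.
Hypothesis k_coprime : coprime n.+1 (ck c).

Let energy (P : 'I_n.+1 -> R * R) := kernel_energy gamma (fst \o P) (snd \o P).

Lemma wce_le_energy (P Q : 'I_n.+1 -> R * R) : point_set P -> point_set Q ->
  (wce gamma P <= wce gamma Q)%E = (energy P <= energy Q).
Proof.
move=> PP QP; rewrite (wceE gamma_gt0 PP) (wceE gamma_gt0 QP) lee_fin.
rewrite ler_sqrt ?tensor_dot_ge0 // !tensor_dot_error_error // lerD2r.
by rewrite ler_pdivrMr ?divfK // ?exprn_gt0 ?ltr0n // expf_neq0 // pnatr_eq0.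
Qed.

Lemma rank1_point_set : point_set (@rank1_lattice R n (ck c)).
Proof.
move=> i; split; last exact: mod1_torus.
by rewrite /= /torus /= divr_ge0 //= ltr_pdivrMr ?ltr0n // mul1r ltr_nat.
Qed.

Let energy_rank1 : energy (@rank1_lattice R n (ck c)) =
  kernel_energy gamma (fun i : 'I_n.+1 => (i : nat)%:R / n.+1%:R)
    (fun i => ((i *+ ck c : 'I_n.+1) : nat)%:R / n.+1%:R).
Proof.
have e i : (rank1_lattice R (ck c) i).2 = ((i *+ ck c : 'I_n.+1) : nat)%:R / n.+1%:R.
  have [q hq] := natr_ordMn R i (ck c).
  apply: (mod1_eq (m := - q)); last by rewrite hq intrN; field; rewrite nat1r.
  by rewrite /torus /= divr_ge0 //= ltr_pdivrMr ?ltr0n // mul1r ltr_nat.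
by apply: eq_bigr => i _; apply: eq_bigr => j _; rewrite /= -!e.
Qed.

Lemma rank1_lattice_minimizer :
  global_minimizer gamma (@rank1_lattice R n (ck c)) /\
  forall P : 'I_n.+1 -> R * R,
    global_minimizer gamma P -> torus_image (@rank1_lattice R n (ck c)) P.
Proof.
have k_inj := ord_mulrn_inj k_coprime.
have lower P := kernel_energy_min cNE c_ok k_inj gamma_gt0 gamma_le6 (fst \o P) (snd \o P).
split; first split; first exact: rank1_point_set.
  move=> Q QP; rewrite (wce_le_energy rank1_point_set QP) energy_rank1.
  exact: (lower Q).1.
move=> P [PP Pmin].
have := Pmin _ rank1_point_set; rewrite (wce_le_energy PP rank1_point_set) energy_rank1.
move=> /(lower P).2 [sig [b [e [x0 [y0 [isig PE]]]]]].
exact: torus_image_rank1 PP isig PE.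
Qed.

End LatticeMinimality.

(** The listed sizes end at 13 = fib 7, so this confines n to at most 7. *)
Lemma fib_ge21 m : (21 <= fib m.+4.+4)%N.
Proof. by elim: m => // m IH; apply: leq_trans IH _; exact: leq_addr. Qed.

Local Open Scope ring_scope.

Theorem mainTheorem1 (R : realType) (gamma : R)
    (hgamma : gamma = 1 \/ gamma = 6%:R)
    (n : nat) (hn : (2 <= n)%N)
    (hN : fib n \in [:: 1; 2; 3; 5; 8; 13]%N) :
  global_minimizer gamma (@fib_lattice R n) /\
  forall P : 'I_(fib n) -> R * R,
    global_minimizer gamma P -> torus_image (@fib_lattice R n) P.
Proof.
have [g0 g6] : 0 < gamma /\ gamma <= 6 by case: hgamma => ->; split; lra.
have /and5P[c1 c2 c3 c5 /and3P[c8 c13 _]] := certificates_ok.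
case: n hn hN => [|[|[|[|[|[|[|[|n]]]]]]]] hn hN.
- by move: hn.
- by move: hn.
(* For concrete n, [fib n] and [fib n.-1] compute, so [fib_lattice] is convertible to
   [rank1_lattice] with k = fib n.-1, and [isT] decides coprimality. *)
- exact: (@rank1_lattice_minimizer R gamma cert1 0 g0 g6 erefl c1 isT).
- exact: (@rank1_lattice_minimizer R gamma cert2 1 g0 g6 erefl c2 isT).
- exact: (@rank1_lattice_minimizer R gamma cert3 2 g0 g6 erefl c3 isT).
- exact: (@rank1_lattice_minimizer R gamma cert5 4 g0 g6 erefl c5 isT).
- exact: (@rank1_lattice_minimizer R gamma cert8 7 g0 g6 erefl c8 isT).
- exact: (@rank1_lattice_minimizer R gamma cert13 12 g0 g6 erefl c13 isT).
- exfalso; have := fib_ge21 n; move: hN; rewrite !inE.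
  by do !(case/orP => [/eqP -> //|]); move=> /eqP ->.
Qed.
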